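(* Let $H$ be a smooth function near the origin in $\mathbb{R}^{2n+1}$ with Darboux coordinates $(q,p,z)=(q_1,\dots,q_n,p_1,\dots,p_n,z)$, and suppose the contact vector field $X_H$ has at the origin a degenerate equilibrium with vanishing principal coefficient (so $H(0)=0$ and $\mathrm{d}H(0)=0$) and that $0$ is a simple eigenvalue of the linear part of $X_H$ at the origin (equivalently, the Hessian of $H$ at $0$ restricted to the $(q,p)$-space is non-degenerate). Then the singularity of $X_H$ at the origin is a fold if $$\Delta_2:=H_{zq}\mathbf{a}_q+H_{zp}\mathbf{a}_p+H_{zz}\neq 0,$$ where $\mathbf{a}_q,\mathbf{a}_p\in\mathbb{R}^n$ satisfy $$H_{qq}\mathbf{a}_q+H_{qp}\mathbf{a}_p+H_{qz}=0,\qquad H_{pq}\mathbf{a}_q+H_{pp}\mathbf{a}_p+H_{pz}=0,$$ all second partial derivatives being evaluated at the origin. Furthermore, in this case, the family $H_\lambda=H-\lambda$ gives a versal unfolding $X_{H_\lambda}$ of the singularity (a saddle-node bifurcation).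
   Context: Contact form: $\eta=\mathrm{d}z-\sum_jp_j\mathrm{d}q_j$. The contact vector field $X_H$ is $\dot q_j=H_{p_j}$, $\dot p_j=-H_{q_j}-p_jH_z$, $\dot z=\sum_jp_jH_{p_j}-H$. The origin is an equilibrium iff $H(0)=0$ and $\mathrm{d}H(0)=-\tau\,\mathrm{d}z$, where $\tau=-H_z(0)$ is the principal coefficient. Block notation: $H_{qq}=(H_{q_iq_j})$, $H_{qp}=(H_{q_ip_j})$, etc.; e.g. the $i$-th component of the first equation is $\sum_j\left(H_{q_iq_j}(\mathbf{a}_q)_j+H_{q_ip_j}(\mathbf{a}_p)_j\right)+H_{q_iz}=0$, and $\Delta_2=\sum_j(H_{zq_j}(\mathbf{a}_q)_j+H_{zp_j}(\mathbf{a}_p)_j)+H_{zz}$. Regard a vector field near an equilibrium at $0$ as a map-germ $F:(\mathbb{R}^m,0)\to(\mathbb{R}^m,0)$ ($m=2n+1$). Two such germs $F,G$ are $\mathcal{K}$-equivalent if $G(x)=A(x)F(\phi(x))$ with $A$ a smooth germ of invertible-matrix-valued map and $\phi$ a diffeomorphism germ fixing $0$. $F$ is a fold if it is $\mathcal{K}$-equivalent to $(x,\mathbf{y})\mapsto(x^2,\mathbf{y})$, $x\in\mathbb{R}$, $\mathbf{y}\in\mathbb{R}^{m-1}$. A deformation (unfolding) $F_\lambda$, $F_0=F$, is versal if every smooth deformation $G_\mu$ of $F$ (with $\mu\in\mathbb{R}^k$, $G_0=F$) has, as germs at $(0,0)$, the form $G_\mu(x)=A(x,\mu)F_{h(\mu)}(\phi(x,\mu))$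 with $A(x,0)=I$, $\phi(x,0)=x$, $h(0)=0$, all smooth. A saddle-node bifurcation of equilibria means a versal 1-parameter unfolding of a fold, so (locally) there are two equilibria on one side of $\lambda=0$ and none on the other. *)

(* Defs.v *)
From HB Require Import structures.
From mathcomp Require Import all_boot all_order all_algebra.
From mathcomp Require Import all_classical all_reals all_analysis.
Set Implicit Arguments.
Unset Strict Implicit.
Unset Printing Implicit Defensive.
Import Order.TTheory GRing.Theory Num.Theory.
Import numFieldNormedType.Exports.
Local Open Scope classical_set_scope.
Local Open Scope ring_scope.

(* All maps below are total functions representing germs: only their values
   near the base point matter. *)

Section Smoothness.
Context {R : realType} {V W : normedModType R}.

(* For V finite-dimensional (the only case used here) this is the usual
   C^k regularity on the open set U. *)
Fixpoint Ck_on (U : set V) (k : nat) (f : V -> W) : Prop :=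
  match k with
  | 0 => forall x, U x -> {for x, continuous f}
  | k'.+1 => (forall x, U x -> differentiable f x) /\
             (forall v : V, Ck_on U k' ('D_v f))
  end.

(* A single neighbourhood serves all orders k, i.e. f is C^oo near x. *)
Definition smooth_germ (x : V) (f : V -> W) : Prop :=
  exists2 U : set V, open_nbhs x U & forall k, Ck_on U k f.

End Smoothness.

Section Derivatives.
Context {R : realType} {m : nat}.

Definition partial (i : 'I_m) (f : 'cV[R]_m -> R) : 'cV[R]_m -> R :=
  'D_(delta_mx i 0) f.

Definition hessian (f : 'cV[R]_m -> R) (x : 'cV[R]_m) : 'M[R]_m :=
  \matrix_(i, j) partial j (partial i f) x.

Definition linear_part (F : 'cV[R]_m -> 'cV[R]_m) (x : 'cV[R]_m) : 'M[R]_m :=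
  \matrix_(i, j) partial j (fun y => F y i 0) x.

Definition degenerate_equilibrium (F : 'cV[R]_m -> 'cV[R]_m) (x : 'cV[R]_m) :=
  F x = 0 /\ \det (linear_part F x) = 0.

(* Simple in the algebraic sense: simple root of the characteristic polynomial *)
Definition simple_eigenvalue (L : 'M[R]_m) (a : R) : Prop :=
  mup a (char_poly L) = 1%N.

End Derivatives.

Section Germs.
Context {R : realType} {m : nat}.
Local Notation E := 'cV[R]_m.

(* (R^m, 0) -> (R^m, 0) *)
Definition map_germ (F : E -> E) : Prop := smooth_germ 0 F /\ F 0 = 0.

Definition diffeo_germ (phi : E -> E) : Prop :=
  map_germ phi /\
  exists psi : E -> E,
    [/\ map_germ psi,
        \forall x \near (0 : E), psi (phi x) = x
      & \forall x \near (0 : E), phi (psi x) = x].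

Definition K_equivalent (F G : E -> E) : Prop :=
  exists (A : E -> 'M[R]_m) (phi : E -> E),
    [/\ smooth_germ 0 A,
        \forall x \near (0 : E), A x \in unitmx,
        diffeo_germ phi
      & \forall x \near (0 : E), G x = A x *m F (phi x)].

(* (x, y) |-> (x ^ 2, y), with x the coordinate of index 0; meant for m > 0 *)
Definition fold_map (w : E) : E :=
  \col_i (if i == 0%N :> nat then w i 0 ^+ 2 else w i 0).

Definition is_fold (F : E -> E) : Prop :=
  map_germ F /\ K_equivalent F fold_map.

(* Parameter space P; F_t is not required to vanish at 0 for t != 0. *)
Definition deformation (P : normedModType R) (F0 : E -> E) (F : P -> E -> E) :=
  smooth_germ (0 : E * P) (fun w : E * P => F w.2 w.1) /\
  \forall x \near (0 : E), F 0 x = F0 x.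

Definition versal (P : normedModType R) (F0 : E -> E) (F : P -> E -> E) : Prop :=
  deformation F0 F /\
  forall (k : nat) (G : 'cV[R]_k -> E -> E), deformation F0 G ->
    exists (A : E * 'cV[R]_k -> 'M[R]_m) (phi : E * 'cV[R]_k -> E)
           (h : 'cV[R]_k -> P),
      [/\ smooth_germ 0 A /\ (\forall x \near (0 : E), A (x, 0) = 1%:M),
          smooth_germ 0 phi /\ (\forall x \near (0 : E), phi (x, 0) = x),
          smooth_germ 0 h /\ h 0 = 0
        & \forall w \near (0 : E * 'cV[R]_k),
            G w.2 w.1 = A w *m F (h w.2) (phi w)].

Definition saddle_node (F0 : E -> E) (F : R -> E -> E) : Prop :=
  is_fold F0 /\ versal (P := R^o) F0 F.

End Germs.

Section Contact.
Context {R : realType} {n : nat}.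

(* Darboux coordinates (q, p, z) on R^(2n+1), contact form dz - p dq *)
Definition qI (i : 'I_n) : 'I_(n + n + 1) := lshift 1 (lshift n i).
Definition pI (i : 'I_n) : 'I_(n + n + 1) := lshift 1 (rshift n i).
Definition zI (i : 'I_1) : 'I_(n + n + 1) := rshift (n + n) i.

Definition contact_field (H : 'cV[R]_(n + n + 1) -> R)
    (w : 'cV[R]_(n + n + 1)) : 'cV[R]_(n + n + 1) :=
  col_mx
    (col_mx (\col_j partial (pI j) H w)
            (\col_j (- partial (qI j) H w - w (pI j) 0 * partial (zI 0) H w)))
    (\col_(_ < 1) (\sum_j w (pI j) 0 * partial (pI j) H w - H w)).

Definition principal_coefficient (H : 'cV[R]_(n + n + 1) -> R) : R :=
  - partial (zI 0) H 0.

(* Blocks of second derivatives at the origin: hblock H qI pI is H_qp, etc. *)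
Definition hblock (H : 'cV[R]_(n + n + 1) -> R) (r s : nat)
    (a : 'I_r -> 'I_(n + n + 1)) (b : 'I_s -> 'I_(n + n + 1)) : 'M[R]_(r, s) :=
  mxsub a b (hessian H 0).

Definition Delta2 (H : 'cV[R]_(n + n + 1) -> R) (aq ap : 'cV[R]_n) : R :=
  (hblock H zI qI *m aq + hblock H zI pI *m ap + hblock H zI zI) 0 0.

End Contact.

(* Main.v *)
From HB Require Import structures.
Require Import Defs.
From mathcomp Require Import all_boot all_order all_algebra.
From mathcomp Require Import perm.
From mathcomp Require Import all_classical all_reals all_analysis.
From mathcomp Require Import ring lra.
Set Implicit Arguments.
Unset Strict Implicit.
Unset Printing Implicit Defensive.
Import Order.TTheory GRing.Theory Num.Theory.
Import numFieldNormedType.Exports.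
Local Open Scope classical_set_scope.
Local Open Scope ring_scope.

(** The last row of the linear part of X_H at the origin vanishes, and, 0 being a
    simple eigenvalue, its (q,p)-block is invertible.  Hence for any deformation
    G = (f, g) of X_H, with g the z-component, (f, z, mu) are local coordinates;
    in them Hadamard's lemma writes g as sum_i c_i f_i plus a function gamma(z, mu)
    with gamma_z = 0 and gamma_zz <> 0 at the origin, where gamma_zz = - Delta2.
    A Morse lemma with parameters turns gamma into s tau^2 + eps(mu), s = 1 or -1.
    So G = A (f, s tau^2 + eps) with A unipotent, fixing the z-axis.  For mu = 0
    this is the fold, and since A fixes the z-axis, X_H + lambda e_z has the normal
    form (f, s tau^2 + lambda); comparing the two normal forms gives versality with
    h = eps. *)

(** * Differentiable and C^k maps *)

(** For versality the normal form of X_H is not computed separately: it is the restriction to mu = 0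
    of the normal form of G. The two therefore share s, c and tau on that slice, and the
    z-components can be compared term by term. The constant - Delta2 comes from the kernel vector xi
    = (a_q, a_p, 1) of the linear part. The second derivative of sum_j p_j H_{p_j} - H along xi is 2
    sum_j xi_{p_j} (Hess xi)_{p_j} - xi^T Hess xi; the equations for a_q and a_p make the (q,p)-part
    of Hess xi vanish, and its z-entry is Delta2. Since [smooth_germ] asks for one neighbourhood
    valid for all orders, the regularity lemmas fix an open set and induct on the order alone. This
    includes the two analytic cores, the inverse map and the averages of Hadamard's lemma, whose
    domains must not shrink as the order grows. *)

Section Differentiability.
Context {R : realType} {V W : normedModType R}.

(** Uniqueness of the differential gives differentiability and the value of ['d f x] from one
    estimate; inverse maps and integrals are differentiated through it. *)
Lemma differentiable_eps (f : V -> W) (x : V) (L : {linear V -> W}) :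
  continuous L ->
  (forall e : R, 0 < e ->
     \forall h \near (0 : V), `|f (h + x) - f x - L h| <= e * `|h|) ->
  differentiable f x /\ 'd f x = L :> (V -> W).
Proof.
move=> Lc fL.
have E : f \o shift x = cst (f x) + L +o_ 0 id.
  apply/eqaddoP => e e0; near=> h.
  rewrite /= !fctE /= opprD addrA.
  by near: h; apply: fL.
have dL := diff_unique Lc E.
split=> //; apply/diff_locallyP; split.
  by rewrite dL.
by rewrite dL.
Unshelve. all: by end_near. Qed.

Lemma differentiable_near0 (f : V -> W) (x : V) : differentiable f x ->
  forall e : R, 0 < e ->
    \forall h \near (0 : V), `|f (h + x) - f x - 'd f x h| <= e * `|h|.
Proof.
move=> /diff_locallyP[_ /eqaddoP fL] e e0.
near=> h.
suff: `|(f \o shift x - (cst (f x) + 'd f x)) h| <= e * `|h|.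
  by rewrite !fctE /= opprD addrA.
by near: h; apply: fL.
Unshelve. all: by end_near. Qed.

Lemma near_eq_differentiable (f g : V -> W) (x : V) :
  (\forall y \near x, f y = g y) -> differentiable f x -> differentiable g x.
Proof.
move=> fg df.
have : differentiable g x /\ 'd g x = 'd f x :> (V -> W).
  apply: differentiable_eps => [|e e0]; first exact: diff_continuous.
  have H2 := differentiable_near0 df e0.
  have H1 : \forall h \near (0 : V), f (h + x) = g (h + x).
    by move: fg => /nbhs0P; apply: filterS => h; rewrite addrC.
  by apply: filterS2 H1 H2 => h <-; rewrite (nbhs_singleton fg).
by case.
Qed.

End Differentiability.

Section DeriveLinear.
Context {R : realType} {V V' W W' : normedModType R}.

(** The two difference quotients coincide, so [f] need not be differentiable. *)
Lemma derive_comp_linear (f : V' -> W) (L : {linear V -> V'}) (v x : V) :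
  'D_v (f \o L) x = 'D_(L v) f (L x).
Proof.
rewrite /derive.
have -> // : (fun h => h^-1 *: ((f \o L) (h *: v + x) - (f \o L) x)) =
             (fun h => h^-1 *: (f (h *: L v + L x) - f (L x))).
by apply/funext => h; rewrite /= linearP.
Qed.

Lemma derive_linear_comp (L : {linear W -> W'}) (f : V -> W) (v x : V) :
  continuous L -> differentiable f x ->
  'D_v (L \o f) x = L ('D_v f x).
Proof.
move=> Lc df.
have dL y : differentiable L y by exact: linear_differentiable.
rewrite !deriveE //; last exact: differentiable_comp.
by rewrite diff_comp //= diff_lin.
Qed.

Lemma derive_linear (L : {linear V -> W}) (v x : V) :
  continuous L -> 'D_v L x = L v.
Proof. by move=> Lc; rewrite deriveE ?diff_lin //; exact: linear_differentiable. Qed.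

End DeriveLinear.

Section Ck.
Context {R : realType} {V : normedModType R}.
Implicit Types (U : set V) (k : nat).

(** Since [U] is open, equality on [U] is equality near each of its points and passes to
    derivatives. Each closure property below computes a derivative on [U] by a formula and
    transports regularity along this lemma. *)
Lemma Ck_on_eq {W : normedModType R} U k (f g : V -> W) : open U ->
  (forall x, U x -> f x = g x) -> Ck_on U k f -> Ck_on U k g.
Proof.
move=> oU; elim: k f g => [|k IH] f g fg /=.
  move=> cf x Ux; have := cf x Ux.
  have near_fg : \forall y \near x, f y = g y.
    by near do apply: fg; exact: open_nbhs_nbhs.
  rewrite /prop_for /continuous_at -(fg x Ux).
  by move=> cfx; apply: cvg_trans cfx; exact: near_eq_cvg.
move=> [df Df]; split=> [x Ux|v].
  apply: near_eq_differentiable (df x Ux).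
  by near do apply: fg; exact: open_nbhs_nbhs.
apply: IH (Df v) => x Ux; apply: near_eq_derive.
by near do apply: fg; exact: open_nbhs_nbhs.
Unshelve. all: by end_near. Qed.

Lemma Ck_on_sub {W : normedModType R} U U' k (f : V -> W) :
  U' `<=` U -> Ck_on U k f -> Ck_on U' k f.
Proof.
move=> U'U; elim: k f => [|k IH] f /=; first by move=> cf x /U'U /cf.
by move=> [df Df]; split=> [x /U'U /df//|v]; exact: IH.
Qed.

Lemma Ck_onW {W : normedModType R} U k (f : V -> W) :
  Ck_on U k.+1 f -> Ck_on U k f.
Proof.
elim: k f => [|k IH] f [df Df].
  by move=> x /df; exact: differentiable_continuous.
by split=> // v; apply: IH.
Qed.

Lemma Ck_on_continuous {W : normedModType R} U k (f : V -> W) :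
  Ck_on U k f -> forall x, U x -> {for x, continuous f}.
Proof. by elim: k f => [//|k IH] f /Ck_onW; exact: IH. Qed.

Lemma Ck_on_cst {W : normedModType R} U k (a : W) : Ck_on U k (cst a : V -> W).
Proof.
elim: k a => [|k IH] a /=; first by move=> x _; exact: cst_continuous.
split=> [x _|v]; first exact: differentiable_cst.
have -> : 'D_v (cst a : V -> W) = cst 0 by apply/funext => x; rewrite derive_cst.
exact: IH.
Qed.

Lemma Ck_on_linear {W : normedModType R} U k (L : {linear V -> W}) :
  continuous L -> Ck_on U k L.
Proof.
move=> Lc; case: k => [|k] /=; first by move=> x _; exact: Lc.
split=> [x _|v]; first exact: linear_differentiable.
have -> : 'D_v L = cst (L v) by apply/funext => x; rewrite derive_linear.
exact: Ck_on_cst.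
Qed.

Lemma Ck_onD {W : normedModType R} U k (f g : V -> W) : open U ->
  Ck_on U k f -> Ck_on U k g -> Ck_on U k (fun x => f x + g x).
Proof.
move=> oU; elim: k f g => [|k IH] f g /=.
  by move=> cf cg x Ux; apply: continuousD; [exact: cf|exact: cg].
move=> [df Df] [dg Dg]; split=> [x Ux|v].
  by apply: differentiableD; [exact: df|exact: dg].
apply: (Ck_on_eq oU _ (IH _ _ (Df v) (Dg v))) => x Ux.
by rewrite deriveD //; apply: diff_derivable; [exact: df|exact: dg].
Qed.

Lemma Ck_on_linear_comp {W W' : normedModType R} U k (L : {linear W -> W'})
  (f : V -> W) : open U -> continuous L -> Ck_on U k f -> Ck_on U k (L \o f).
Proof.
move=> oU Lc; elim: k f => [|k IH] f /=.
  by move=> cf x Ux; apply: continuous_comp; [exact: cf|exact: Lc].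
move=> [df Df]; split=> [x Ux|v].
  apply: differentiable_comp; first exact: df.
  exact: linear_differentiable.
apply: (Ck_on_eq oU _ (IH _ (Df v))) => x Ux.
by rewrite derive_linear_comp //; exact: df.
Qed.

Lemma Ck_on_comp_linear {V' W : normedModType R} U (U' : set V') k
  (L : {linear V -> V'}) (f : V' -> W) : open U -> continuous L ->
  (forall x, U x -> U' (L x)) -> Ck_on U' k f -> Ck_on U k (f \o L).
Proof.
move=> oU Lc UU'; elim: k f => [|k IH] f /=.
  by move=> cf x Ux; apply: continuous_comp; [exact: Lc|exact/cf/UU'].
move=> [df Df]; split=> [x Ux|v].
  apply: differentiable_comp; first exact: linear_differentiable.
  exact/df/UU'.
apply: (Ck_on_eq oU _ (IH _ (Df (L v)))) => x Ux.
by rewrite derive_comp_linear.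
Qed.

Lemma Ck_onM U k (f g : V -> R^o) : open U ->
  Ck_on U k f -> Ck_on U k g -> Ck_on U k (fun x => f x * g x : R^o).
Proof.
move=> oU; elim: k f g => [|k IH] f g.
  by move=> cf cg x Ux; apply: continuousM; [exact: cf|exact: cg].
move=> /[dup] Cf [df Df] /[dup] Cg [dg Dg]; split=> [x Ux|v].
  by apply: differentiableM; [exact: df|exact: dg].
apply: (Ck_on_eq oU _ (Ck_onD oU (IH _ _ (Ck_onW Cf) (Dg v))
                                 (IH _ _ (Ck_onW Cg) (Df v)))) => x Ux.
by rewrite deriveM //; apply: diff_derivable; [exact: df|exact: dg].
Qed.

Lemma Ck_on_sum {W : normedModType R} {I : Type} (r : seq I) (P : pred I) U k
  (f : I -> V -> W) : open U -> (forall i, Ck_on U k (f i)) ->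
  Ck_on U k (fun x => \sum_(i <- r | P i) f i x).
Proof.
move=> oU Cf; elim: r => [|i r IH].
  by apply: (Ck_on_eq oU _ (Ck_on_cst _ _ (0 : W))) => x _; rewrite big_nil.
have [Pi|nPi] := boolP (P i).
  by apply: (Ck_on_eq oU _ (Ck_onD oU (Cf i) IH)) => x _; rewrite big_cons Pi.
by apply: (Ck_on_eq oU _ IH) => x _; rewrite big_cons (negbTE nPi).
Qed.

Lemma Ck_on_prod {I : Type} (r : seq I) (P : pred I) U k
  (f : I -> V -> R^o) : open U -> (forall i, Ck_on U k (f i)) ->
  Ck_on U k (fun x => \prod_(i <- r | P i) f i x : R^o).
Proof.
move=> oU Cf; elim: r => [|i r IH].
  by apply: (Ck_on_eq oU _ (Ck_on_cst _ _ (1 : R^o))) => x _; rewrite big_nil.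
have [Pi|nPi] := boolP (P i).
  by apply: (Ck_on_eq oU _ (Ck_onM oU (Cf i) IH)) => x _; rewrite big_cons Pi.
by apply: (Ck_on_eq oU _ IH) => x _; rewrite big_cons (negbTE nPi).
Qed.

(** The derivative - f^-2 D_v f involves the inverse only at the previous order, which the induction
    supplies. *)
Lemma Ck_onV U k (f : V -> R^o) : open U -> (forall x, U x -> f x != 0) ->
  Ck_on U k f -> Ck_on U k (fun x => (f x)^-1 : R^o).
Proof.
move=> oU f0; elim: k => [|k IH].
  by move=> cf x Ux; apply: continuousV; [exact: f0|exact: cf].
move=> /[dup] Cf [df Df]; split=> [x Ux|v].
  by apply: differentiableV; [exact: df|exact: f0].
have CV := IH (Ck_onW Cf).
have C1 := Ck_onM oU (Ck_on_cst _ _ (-1 : R^o)) (Ck_onM oU (Ck_onM oU CV CV) (Df v)).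
apply: (Ck_on_eq oU _ C1) => x Ux.
rewrite deriveV ?f0 //; last by apply: diff_derivable; exact: df.
by rewrite /cst mulN1r -invfM -expr2 scaleNr.
Qed.

End Ck.

Section ScalarDerivatives.
Context {R : realType} {V : normedModType R}.

Lemma deriveM_fun (f g : V -> R^o) v x : differentiable f x -> differentiable g x ->
  'D_v (fun y => f y * g y : R^o) x = f x * 'D_v g x + g x * 'D_v f x.
Proof. by move=> df dg; rewrite (@deriveM _ _ f g) //; exact: diff_derivable. Qed.

Lemma deriveB_fun (f g : V -> R^o) v x : differentiable f x -> differentiable g x ->
  'D_v (fun y => f y - g y : R^o) x = 'D_v f x - 'D_v g x.
Proof. by move=> df dg; rewrite (@deriveB _ _ _ f g) //; exact: diff_derivable. Qed.

Lemma deriveN_fun (f : V -> R^o) v x : differentiable f x ->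
  'D_v (fun y => - f y : R^o) x = - 'D_v f x.
Proof. by move=> df; rewrite (@deriveN _ _ _ f) //; exact: diff_derivable. Qed.

Lemma derive_sum_fun n (f : 'I_n -> V -> R^o) v x : (forall i, differentiable (f i) x) ->
  'D_v (fun y => \sum_i f i y : R^o) x = \sum_i 'D_v (f i) x.
Proof.
move=> df.
have -> : (fun y => \sum_i f i y : R^o) = \sum_i f i.
  by apply/funext => y; rewrite fct_sumE.
by rewrite derive_sum // => i; exact: diff_derivable.
Qed.

End ScalarDerivatives.

(** * Matrix entries, the chain rule, determinants and inverses *)

Section Coordinates.
Context {R : realType} {p q : nat}.

(** Reading an entry, and below multiplying a fixed matrix by a scalar, are packaged as linear maps,
    so that composition with continuous linear maps moves regularity between a matrix and its
    entries. *)
Definition mxcoord (i : 'I_p) (j : 'I_q) (M : 'M[R]_(p, q)) : R^o := M i j.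

Fact mxcoord_linear i j : linear (mxcoord i j).
Proof. by move=> a M N; rewrite /mxcoord !mxE. Qed.
HB.instance Definition _ i j :=
  GRing.isLinear.Build R 'M[R]_(p, q) R^o _ (mxcoord i j) (mxcoord_linear i j).

Lemma mxcoord_continuous i j : continuous (mxcoord i j).
Proof. exact: coord_continuous. Qed.

Definition mxscalel (D : 'M[R]_(p, q)) (r : R^o) : 'M[R]_(p, q) := r *: D.

Fact mxscalel_linear D : linear (mxscalel D).
Proof. by move=> a r s; rewrite /mxscalel scalerDl scalerA. Qed.
HB.instance Definition _ D :=
  GRing.isLinear.Build R R^o 'M[R]_(p, q) _ (mxscalel D) (mxscalel_linear D).

Lemma mxscalel_continuous D : continuous (mxscalel D).
Proof. exact: scalel_continuous. Qed.

Lemma linear_col_continuous {N : nat} {W : normedModType R}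
  (L : {linear 'cV[R]_N -> W}) : continuous L.
Proof.
have -> : (L : 'cV[R]_N -> W) = fun x => \sum_i (x i 0) *: L (delta_mx i 0).
  apply/funext => x; rewrite [in LHS](matrix_sum_delta x) linear_sum.
  by apply: eq_bigr => i _; rewrite big_ord1 linearZ.
move=> x.
apply: (@Ck_on_sum R 'cV[R]_N W _ (index_enum _) xpredT setT 0
  (fun i x => x i 0 *: L (delta_mx i 0)) openT _ x I) => i y _.
apply: (@continuousZr_tmp _ _ _ (fun x : 'cV[R]_N => x i 0 : R^o)).
exact: coord_continuous.
Qed.

End Coordinates.

Section ChainRule.
Context {R : realType}.

Lemma derive_compose {V W Z : normedModType R} (f : V -> W) (g : W -> Z)
  (v x : V) : differentiable f x -> differentiable g (f x) ->
  'D_v (g \o f) x = 'D_('D_v f x) g (f x).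
Proof.
move=> df dg; rewrite !deriveE //; last exact: differentiable_comp.
by rewrite diff_comp.
Qed.

Lemma derive_partial {N : nat} {W : normedModType R} (g : 'cV[R]_N -> W)
  (u y : 'cV[R]_N) : differentiable g y ->
  'D_u g y = \sum_i u i 0 *: 'D_(delta_mx i 0) g y.
Proof.
move=> dg; rewrite deriveE // [in LHS](matrix_sum_delta u) linear_sum.
by apply: eq_bigr => i _; rewrite big_ord1 linearZ -deriveE.
Qed.

Lemma derive_coord {V : normedModType R} {p q : nat} (f : V -> 'M[R]_(p, q))
  (v x : V) i j : differentiable f x ->
  'D_v (fun y => f y i j : R^o) x = ('D_v f x) i j.
Proof.
move=> df.
by have := derive_linear_comp v (@mxcoord_continuous R p q i j) df.
Qed.

End ChainRule.

Section CkCoord.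
Context {R : realType} {V : normedModType R}.
Implicit Types (U : set V) (k : nat).

Lemma Ck_on_coord {p q : nat} U k (f : V -> 'M[R]_(p, q)) i j : open U ->
  Ck_on U k f -> Ck_on U k (fun x => f x i j : R^o).
Proof.
by move=> oU; apply: (Ck_on_linear_comp oU (@mxcoord_continuous R p q i j)).
Qed.

End CkCoord.

Section CkMatrix.
Context {R : realType} {V : normedModType R}.
Implicit Types (U : set V) (k : nat).

Lemma Ck_on_mx {p q : nat} U k (f : V -> 'M[R]_(p, q)) : open U ->
  (forall i j, Ck_on U k (fun x => f x i j : R^o)) -> Ck_on U k f.
Proof.
move=> oU Cf.
have C1 := Ck_on_sum (index_enum _) xpredT oU (fun i =>
  Ck_on_sum (index_enum _) xpredT oU (fun j =>
  Ck_on_linear_comp oU (@mxscalel_continuous R p q (delta_mx i j)) (Cf i j))).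
by apply: (Ck_on_eq oU _ C1) => x _; rewrite [in RHS](matrix_sum_delta (f x)).
Qed.

(** [Ck_on] differentiates in constant directions only, whereas the chain rule yields the moving
    direction D_v f x. On columns it expands as sum_i (D_v f)_i (D_i g o f), and the induction
    applies to each partial of [g] with [f] unchanged. *)
Lemma Ck_on_comp_scalar {N : nat} U (U' : set 'cV[R]_N) k
  (f : V -> 'cV[R]_N) (g : 'cV[R]_N -> R^o) : open U ->
  (forall x, U x -> U' (f x)) -> Ck_on U k f -> Ck_on U' k g ->
  Ck_on U k (g \o f).
Proof.
move=> oU UU'; elim: k g => [|k IH] g.
  by move=> cf cg x Ux; apply: continuous_comp; [exact: cf|exact/cg/UU'].
move=> /[dup] Cf [df Df] [dg Dg]; split=> [x Ux|v].
  by apply: differentiable_comp; [exact: df|exact/dg/UU'].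
have C1 := Ck_on_sum (index_enum _) xpredT oU (fun i : 'I_N =>
  Ck_onM oU (Ck_on_coord i 0 oU (Df v)) (IH _ (Ck_onW Cf) (Dg (delta_mx i 0)))).
apply: (Ck_on_eq oU _ C1) => x Ux.
by rewrite (derive_compose v (df x Ux) (dg _ (UU' _ Ux))) (derive_partial _ (dg _ (UU' _ Ux))).
Qed.

Lemma Ck_on_comp {N p q : nat} U (U' : set 'cV[R]_N) k
  (f : V -> 'cV[R]_N) (g : 'cV[R]_N -> 'M[R]_(p, q)) : open U -> open U' ->
  (forall x, U x -> U' (f x)) -> Ck_on U k f -> Ck_on U' k g ->
  Ck_on U k (g \o f).
Proof.
move=> oU oU' UU' Cf Cg; apply: Ck_on_mx => // i j.
exact: (Ck_on_comp_scalar oU UU' Cf (Ck_on_coord i j oU' Cg)).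
Qed.

Lemma Ck_on_mulmx {p q r : nat} U k (f : V -> 'M[R]_(p, q)) (g : V -> 'M[R]_(q, r)) :
  open U -> Ck_on U k f -> Ck_on U k g -> Ck_on U k (fun x => f x *m g x).
Proof.
move=> oU Cf Cg; apply: Ck_on_mx => // i j.
have C1 := Ck_on_sum (index_enum _) xpredT oU (fun l : 'I_q =>
  Ck_onM oU (Ck_on_coord i l oU Cf) (Ck_on_coord l j oU Cg)).
by apply: (Ck_on_eq oU _ C1) => x _; rewrite mxE.
Qed.

Lemma Ck_on_det {p : nat} U k (f : V -> 'M[R]_p) : open U ->
  Ck_on U k f -> Ck_on U k (fun x => \det (f x) : R^o).
Proof.
move=> oU Cf.
have C1 := (Ck_on_sum (index_enum _) xpredT oU (fun s : 'S_p =>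
  Ck_onM oU (Ck_on_cst _ _ ((-1) ^+ s : R^o))
    (Ck_on_prod (index_enum _) xpredT oU (fun i =>
       Ck_on_coord i (s i) oU Cf)))).
exact: Ck_on_eq oU _ C1.
Qed.

(** Cramer's rule: the entries are cofactors divided by the determinant. *)
Lemma Ck_on_invmx {p : nat} U k (f : V -> 'M[R]_p) : open U ->
  (forall x, U x -> f x \in unitmx) ->
  Ck_on U k f -> Ck_on U k (fun x => invmx (f x)).
Proof.
move=> oU uf Cf; apply: Ck_on_mx => // i j.
have detN0 x : U x -> \det (f x) != 0.
  by move=> /uf; rewrite unitmxE unitfE.
have Cadj : Ck_on U k (fun x => \adj (f x) i j : R^o).
  have Cm : Ck_on U k (fun x => row' j (col' i (f x))).
    apply: Ck_on_mx => // a b.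
    apply: (Ck_on_eq oU _ (Ck_on_coord (lift j a) (lift i b) oU Cf)) => x _.
    by rewrite !mxE.
  have C1 := Ck_onM oU (Ck_on_cst _ _ ((-1) ^+ (j + i) : R^o)) (Ck_on_det oU Cm).
  by apply: (Ck_on_eq oU _ C1) => x _; rewrite mxE.
have C2 := Ck_onM oU (Ck_onV oU detN0 (Ck_on_det oU Cf)) Cadj.
by apply: (Ck_on_eq oU _ C2) => x Ux; rewrite /invmx uf // !mxE.
Qed.

End CkMatrix.

(** Same bootstrap as for inverses, from the derivative D_v f / (2 sqrt f). *)
Lemma Ck_on_sqrt {R : realType} {V : normedModType R} (U : set V) k (f : V -> R^o) :
  open U -> (forall x, U x -> 0 < f x) ->
  Ck_on U k f -> Ck_on U k (fun x => Num.sqrt (f x) : R^o).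
Proof.
move=> oU f0; elim: k => [|k IH].
  move=> cf x Ux.
  exact: (@continuous_comp _ _ _ f (@Num.sqrt R) x (cf x Ux) (@sqrt_continuous R _)).
have ds (y : R^o) : 0 < y -> differentiable (@Num.sqrt R : R^o -> R^o) y.
  by move=> y0; apply/derivable1_diffP; have [] := is_derive1_sqrt y0.
move=> /[dup] Cf [df Df]; split=> [x Ux|v].
  apply: (@differentiable_comp _ _ _ _ f (@Num.sqrt R : R^o -> R^o)); first exact: df.
  exact/ds/f0.
have CS := IH (Ck_onW Cf).
have S0 x : U x -> (Num.sqrt (f x) : R^o) != 0.
  by move=> /f0; rewrite -sqrtr_gt0 => /gt_eqF ->.
have C1 := Ck_onM oU (Ck_on_cst _ _ (2^-1 : R^o))
             (Ck_onM oU (Df v) (Ck_onV oU S0 CS)).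
apply: (Ck_on_eq oU _ C1) => x Ux.
rewrite (@derive_compose _ _ _ _ f (@Num.sqrt R : R^o -> R^o) v x (df x Ux) (ds _ (f0 x Ux))).
have dsx := ds _ (f0 x Ux).
have E : 'D_('D_v f x) (@Num.sqrt R : R^o -> R^o) (f x) =
         'D_v f x *: 'D_(1 : R^o) (@Num.sqrt R : R^o -> R^o) (f x).
  rewrite (deriveE _ dsx) (deriveE (1 : R^o) dsx) -linearZ; congr ('d _ _ _).
  by rewrite -[RHS]/(_ * 1) mulr1.
rewrite E derive_sqrt ?f0 // invfM /cst mulrCA; reflexivity.
Qed.

(** * Smooth germs *)

Section SmoothGerm.
Context {R : realType} {V : normedModType R}.
Implicit Types (x : V).

Lemma smooth_germ_within {W : normedModType R} x (f : V -> W) (P : set V) :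
  smooth_germ x f -> nbhs x P ->
  exists2 U, open_nbhs x U /\ U `<=` P & forall k, Ck_on U k f.
Proof.
move=> [U xU CU] xP; exists (U `&` P°).
  split; last by move=> y [_ /interior_subset].
  by apply: open_nbhsI => //; split; [exact: open_interior|exact: nbhs_singleton (nbhs_interior xP)].
by move=> k; apply: Ck_on_sub (CU k) => y [].
Qed.

Lemma smooth_near_eq {W : normedModType R} x (f g : V -> W) :
  (\forall y \near x, f y = g y) -> smooth_germ x f -> smooth_germ x g.
Proof.
move=> fg sf; have [U [xU UP] CU] := smooth_germ_within sf fg.
by exists U => // k; apply: Ck_on_eq (CU k) => //; case: xU.
Qed.

Lemma smooth_eq {W : normedModType R} x (f g : V -> W) :
  f =1 g -> smooth_germ x f -> smooth_germ x g.
Proof. by move=> fg; apply: smooth_near_eq; near do exact: fg. Unshelve. all: by end_near. Qed.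

Lemma smooth_continuous {W : normedModType R} x (f : V -> W) :
  smooth_germ x f -> {for x, continuous f}.
Proof. by move=> [U [oU Ux] /(_ 0%N) CU]; exact: CU. Qed.

Lemma smooth_near_open {W : normedModType R} x (f : V -> W) :
  smooth_germ x f -> \forall y \near x, smooth_germ y f.
Proof.
move=> [U [oU Ux] CU]; have : \forall y \near x, U y by exact: open_nbhs_nbhs.
by apply: filterS => y Uy; exists U.
Qed.

Lemma smooth_differentiable {W : normedModType R} x (f : V -> W) :
  smooth_germ x f -> differentiable f x.
Proof. by move=> [U [oU Ux] /(_ 1%N) [df _]]; exact: df. Qed.

Lemma smooth_near_differentiable {W : normedModType R} x (f : V -> W) :
  smooth_germ x f -> \forall y \near x, differentiable f y.
Proof. by move=> /smooth_near_open; apply: filterS => y; exact: smooth_differentiable. Qed.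

Lemma smooth_derive {W : normedModType R} x (f : V -> W) v :
  smooth_germ x f -> smooth_germ x ('D_v f).
Proof. by move=> [U xU CU]; exists U => // k; have [_] := CU k.+1; apply. Qed.

Lemma smooth_cst {W : normedModType R} x (a : W) : smooth_germ x (cst a : V -> W).
Proof. by exists setT; [split=> //; exact: openT|move=> k; exact: Ck_on_cst]. Qed.

Lemma smooth_linear {W : normedModType R} x (L : {linear V -> W}) :
  continuous L -> smooth_germ x L.
Proof. by exists setT; [split=> //; exact: openT|move=> k; exact: Ck_on_linear]. Qed.

Lemma smoothD {W : normedModType R} x (f g : V -> W) :
  smooth_germ x f -> smooth_germ x g -> smooth_germ x (fun y => f y + g y).
Proof.
move=> sf [U' xU' CU'].
have [U [xU UU'] CU] := smooth_germ_within sf (open_nbhs_nbhs xU').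
exists U => // k; apply: Ck_onD => //; first by case: xU.
exact: Ck_on_sub (CU' k).
Qed.

Lemma smoothM x (f g : V -> R^o) :
  smooth_germ x f -> smooth_germ x g -> smooth_germ x (fun y => f y * g y : R^o).
Proof.
move=> sf [U' xU' CU'].
have [U [xU UU'] CU] := smooth_germ_within sf (open_nbhs_nbhs xU').
exists U => // k; apply: Ck_onM => //; first by case: xU.
exact: Ck_on_sub (CU' k).
Qed.

Lemma smooth_sqrt x (f : V -> R^o) : 0 < f x ->
  smooth_germ x f -> smooth_germ x (fun y => Num.sqrt (f y) : R^o).
Proof.
move=> fx0 sf.
have f0 : \forall y \near x, 0 < f y.
  have := smooth_continuous sf; move/cvgrPdist_lt => /(_ (f x) fx0).
  by apply: filterS => y /ltr_normlW; rewrite ltrBlDr ltrDl.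
have [U [xU UP] CU] := smooth_germ_within sf f0.
by exists U => // k; apply: Ck_on_sqrt => //; case: xU.
Qed.

Lemma smooth_sum {W : normedModType R} {I : Type} (r : seq I) (P : pred I) x
  (f : I -> V -> W) : (forall i, P i -> smooth_germ x (f i)) ->
  smooth_germ x (fun y => \sum_(i <- r | P i) f i y).
Proof.
move=> sf; elim: r => [|i r IH].
  by apply: smooth_eq (smooth_cst x (0 : W)) => y; rewrite big_nil.
have [Pi|nPi] := boolP (P i).
  by apply: smooth_eq (smoothD (sf i Pi) IH) => y; rewrite big_cons Pi.
by apply: smooth_eq IH => y; rewrite big_cons (negbTE nPi).
Qed.

Lemma smooth_linear_comp {W W' : normedModType R} x (L : {linear W -> W'})
  (f : V -> W) : continuous L -> smooth_germ x f -> smooth_germ x (L \o f).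
Proof.
by move=> Lc [U xU CU]; exists U => // k; apply: Ck_on_linear_comp => //; case: xU.
Qed.

Lemma smooth_comp_linear {V' W : normedModType R} x
  (L : {linear V -> V'}) (f : V' -> W) : continuous L ->
  smooth_germ (L x) f -> smooth_germ x (f \o L).
Proof.
move=> Lc [U' [oU' U'x] CU']; exists (L @^-1` U').
  by split=> //; apply: open_comp => // y _; exact: Lc.
move=> k; apply: (Ck_on_comp_linear (U' := U')) => //.
by apply: open_comp => // y _; exact: Lc.
Qed.

Lemma smooth_coord {p q : nat} x (f : V -> 'M[R]_(p, q)) i j :
  smooth_germ x f -> smooth_germ x (fun y => f y i j : R^o).
Proof. exact: smooth_linear_comp (@mxcoord_continuous R p q i j). Qed.

Lemma smooth_mx {p q : nat} x (f : V -> 'M[R]_(p, q)) :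
  (forall i j, smooth_germ x (fun y => f y i j : R^o)) -> smooth_germ x f.
Proof.
move=> sf.
have C1 := @smooth_sum _ _ (index_enum _) xpredT x _ (fun i _ =>
  @smooth_sum _ _ (index_enum _) xpredT x _ (fun j _ =>
  smooth_linear_comp (@mxscalel_continuous R p q (delta_mx i j)) (sf i j))).
by apply: smooth_eq C1 => y; rewrite [in RHS](matrix_sum_delta (f y)).
Qed.

Lemma smooth_comp {N : nat} x (f : V -> 'cV[R]_N) (g : 'cV[R]_N -> R^o) :
  smooth_germ x f -> smooth_germ (f x) g -> smooth_germ x (g \o f).
Proof.
move=> sf [U' xU' CU'].
have [U [xU UU'] CU] := smooth_germ_within sf (smooth_continuous sf (open_nbhs_nbhs xU')).
by exists U => // k; apply: (Ck_on_comp_scalar (U' := U')) => //; case: xU.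
Qed.

End SmoothGerm.

Section SmoothGermVec.
Context {R : realType} {V : normedModType R}.
Implicit Types (x : V).

Lemma smooth_comp_mx {N p q : nat} x (f : V -> 'cV[R]_N) (g : 'cV[R]_N -> 'M[R]_(p, q)) :
  smooth_germ x f -> smooth_germ (f x) g -> smooth_germ x (g \o f).
Proof.
move=> sf sg; apply: smooth_mx => i j.
exact: (smooth_comp sf (smooth_coord i j sg)).
Qed.

Lemma smooth_mulmx {p q r : nat} x (f : V -> 'M[R]_(p, q)) (g : V -> 'M[R]_(q, r)) :
  smooth_germ x f -> smooth_germ x g -> smooth_germ x (fun y => f y *m g y).
Proof.
move=> sf sg; apply: smooth_mx => i j.
have C1 := @smooth_sum _ _ _ _ (index_enum _) xpredT x _ (fun l _ =>
  smoothM (smooth_coord i l sf) (smooth_coord l j sg)).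
by apply: smooth_eq C1 => y; rewrite mxE.
Qed.

Lemma smoothN x (f : V -> R^o) :
  smooth_germ x f -> smooth_germ x (fun y => - f y : R^o).
Proof.
move=> sf; apply: smooth_eq (smoothM (smooth_cst x (-1 : R^o)) sf) => y.
by rewrite /cst mulN1r.
Qed.

Lemma smooth_id x : smooth_germ x (@idfun V).
Proof. by apply: smooth_linear => y; exact: cvg_id. Qed.

End SmoothGermVec.

(** * The inverse function theorem *)

Section ColumnNorm.
Context {R : realType} {N : nat}.
Implicit Types x : 'cV[R]_N.

Lemma coord_le_norm x i : `|x i 0| <= `|x|.
Proof.
by rewrite [leRHS]/Num.Def.normr /= mx_normrE; apply: (le_bigmax _ (fun k => `|x k.1 k.2|) (i, 0)).
Qed.

Lemma norm_col_le x (c : R) : 0 <= c -> (forall i, `|x i 0| <= c) -> `|x| <= c.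
Proof.
move=> c0 xc; rewrite [leLHS]/Num.Def.normr /= mx_normrE.
by apply: bigmax_le => // -[i j] _; rewrite ord1.
Qed.

End ColumnNorm.

Section Balls.
Context {R : realType} {V : normedModType R}.

Lemma near0_ball (P : set V) : (\forall x \near (0 : V), P x) ->
  exists2 r : R, 0 < r & forall x, `|x| < r -> P x.
Proof. by move=> /nbhs_norm0P[r r0 rP]; exists r. Qed.

Lemma open_norm_lt (r : R) : open [set x : V | `|x| < r].
Proof.
apply: (@open_comp V R^o (fun x => `|x|) [set y | y < r]); last exact: open_lt.
by move=> x _; exact: norm_continuous.
Qed.

Lemma closed_norm_le (r : R) : closed [set x : V | `|x| <= r].
Proof.
apply: (@closed_comp V R^o (fun x => `|x|) [set y | y <= r]); last exact: closed_le.
by move=> x _; exact: norm_continuous.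
Qed.

Lemma convex_norm_lt (x v : V) (r t : R) : `|x| < r -> `|v + x| < r ->
  0 <= t <= 1 -> `|t *: v + x| < r.
Proof.
move=> xr vxr /andP[t0 t1].
have -> : t *: v + x = t *: (v + x) + (1 - t) *: x.
  by rewrite scalerDr scalerBl scale1r -addrA [t *: x + _]addrC subrK.
apply: le_lt_trans (ler_normD _ _) _; rewrite !normrZ !ger0_norm ?subr_ge0 //.
have [->|tN0] := eqVneq t 0; first by rewrite mul0r add0r subr0 mul1r.
have t0' : 0 < t by rewrite lt_def tN0.
have : t * `|v + x| < t * r by rewrite ltr_pM2l.
have : (1 - t) * `|x| <= (1 - t) * r by rewrite ler_wpM2l ?subr_ge0 // ltW.
lra.
Qed.

Lemma mean_value (f : V -> R^o) (x v : V) :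
  (forall t : R, 0 <= t <= 1 -> differentiable f (t *: v + x)) ->
  exists2 t : R, 0 <= t <= 1 & f (v + x) - f x = 'D_v f (t *: v + x).
Proof.
move=> df.
have dl (t : R^o) : differentiable (fun t : R^o => t *: v + x) t.
  apply: differentiableD; last exact: differentiable_cst.
  exact: ex_diff.
have Dl (t : R^o) : 'D_1 (fun t : R^o => t *: v + x) t = v.
  rewrite deriveD; last 2 first.
  - by apply: diff_derivable; exact: ex_diff.
  - exact: derivable_cst.
  rewrite derive_cst addr0 deriveE; last exact: ex_diff.
  by rewrite diff_val scale1r.
pose g (t : R) : R := f (t *: v + x).
have dg (t : R) : 0 <= t <= 1 -> is_derive (t : R^o) (1 : R^o) (g : R^o -> R^o) ('D_v f (t *: v + x)).
  move=> t01; apply: DeriveDef.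
    apply: diff_derivable; apply: differentiable_comp; first exact: dl.
    exact: df.
  by rewrite (derive_compose _ (dl t) (df t t01)) Dl.
have [|||c c01] := @MVT R g (fun t => 'D_v f (t *: v + x)) 0 1.
- exact: ltr01.
- by move=> t; rewrite in_itv /= => /andP[t0 t1]; apply: dg; rewrite !ltW.
- apply: derivable_within_continuous => t; rewrite in_itv /= => t01.
  by have [] := dg t t01.
rewrite /g scale1r scale0r add0r subr0 mulr1 => E; exists c => //.
by move: c01; rewrite in_itv /= => /andP[c0 c1]; rewrite !ltW.
Qed.

End Balls.

Section Lipschitz.
Context {R : realType} {N : nat}.

Lemma derive_le_partial (f : 'cV[R]_N -> R^o) (x v : 'cV[R]_N) (e : R) :
  differentiable f x ->
  (forall i, `|'D_(delta_mx i 0) f x| <= e) -> `|'D_v f x| <= N%:R * e * `|v|.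
Proof.
move=> df fe; rewrite derive_partial //.
apply: le_trans (ler_norm_sum _ _ _) _.
have -> : N%:R * e * `|v| = \sum_(i < N) `|v| * e.
  by rewrite sumr_const card_ord -[RHS]mulr_natl; ring.
by apply: ler_sum => i _; rewrite normrM ler_pM // coord_le_norm.
Qed.

Lemma lipschitz_partial (f : 'cV[R]_N -> R^o) (r e : R) :
  (forall x, `|x| < r -> differentiable f x) ->
  (forall x i, `|x| < r -> `|'D_(delta_mx i 0) f x| <= e) ->
  forall x y, `|x| < r -> `|y| < r -> `|f x - f y| <= N%:R * e * `|x - y|.
Proof.
move=> df fe x y xr yr.
have seg t : 0 <= t <= 1 -> `|t *: (x - y) + y| < r.
  by apply: convex_norm_lt => //; rewrite subrK.
have [t t01] := mean_value (fun t t01 => df _ (seg t t01)).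
rewrite subrK => ->; apply: derive_le_partial; first exact/df/seg.
by move=> i; exact/fe/seg.
Qed.

End Lipschitz.

(* Makes matrices a completeNormedModType, as needed for Banach's fixed point. *)
HB.instance Definition _ (R : realType) m n := Complete.on 'M[R]_(m, n).

Section InverseFunction.
Context {R : realType} {N : nat}.
Local Notation E := 'cV[R]_N.

(** A solution of T x = y is a fixed point of x |-> y + (x - T x), a contraction of ratio 1/2 that
    maps the closed ball of radius r to itself because |y| + |x| / 2 <= r. *)
Lemma perturbed_identity_surjective (T : E -> E) (r : R) : 0 < r -> T 0 = 0 ->
  (forall x y, `|x| <= r -> `|y| <= r -> `|(x - T x) - (y - T y)| <= 2^-1 * `|x - y|) ->
  forall y, `|y| < r / 2 -> exists2 x, `|x| < r & T x = y.
Proof.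
move=> r0 T0 hL y yr.
pose U := [set x : E | `|x| <= r].
pose f x := y + (x - T x).
have h0 x : `|x| <= r -> `|x - T x| <= 2^-1 * `|x|.
  move=> xr; have := hL x 0 xr; rewrite normr0 T0 !subr0; apply; exact: ltW.
have fU : {homo f : x / U x >-> U x}.
  move=> x Ux; rewrite /U /=; apply: le_trans (ler_normD _ _) _.
  have := h0 x Ux; move: Ux; rewrite /U /=; lra.
have [] := @banach_fixed_point R E U (mkfun_fun fU).
- exists (2^-1)%:nng; split=> /=; first by rewrite invf_lt1 // ltr1n.
  move=> [x z] /= [Ux Uz]; rewrite /self_sub /= /mkfun /f.
  by rewrite opprD addrACA subrr add0r; exact: hL.
- exact: closed_norm_le.
- by exists 0; rewrite /U /= normr0 ltW.
move=> x Ux; rewrite /mkfun_fun /= /mkfun /f => xE.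
have Tx : T x = y.
  move: xE; rewrite addrCA -[X in X = _]addr0 => /addrI/eqP.
  by rewrite eq_sym subr_eq0 => /eqP.
(* The bound is strict: |x| <= |x| / 2 + |y| with |y| < r / 2. *)
exists x => //; have := h0 x Ux; have := ler_normD (x - T x) (T x).
rewrite subrK Tx; move: yr; lra.
Qed.

Lemma unitmx_injective (A : 'M[R]_N) :
  (forall v : 'cV[R]_N, A *m v = 0 -> v = 0) -> A \in unitmx.
Proof.
move=> Ainj; rewrite -unitmx_tr -row_free_unit; apply: inj_row_free => v vA.
rewrite -[v]trmxK (Ainj v^T) ?trmx0 //.
by rewrite -[A]trmxK -trmx_mul vA trmx0.
Qed.

Lemma derive_linear_part (F : E -> E) x v : differentiable F x ->
  'D_v F x = linear_part F x *m v.
Proof.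
move=> dF; rewrite derive_partial //; apply/colP => i.
rewrite summxE mxE; apply: eq_bigr => j _; rewrite !mxE mulrC; congr (_ * _).
by rewrite /partial derive_coord.
Qed.

Lemma mulmx_col_bound (A : 'M[R]_N) : exists2 c, 0 < c & forall v : E, `|A *m v| <= c * `|v|.
Proof.
pose L : {linear E -> E} := mulmx A.
have Lc : continuous L by exact: linear_col_continuous.
have [c c0 cL] := linear_lipschitz Lc.
by exists c.
Qed.

Lemma Ck_on_linear_part (F : E -> E) (U : set E) k : open U ->
  Ck_on U k.+1 F -> Ck_on U k (linear_part F).
Proof.
move=> oU [dF CF]; apply: Ck_on_mx => // i j.
apply: (Ck_on_eq oU _ (Ck_on_coord i 0 oU (CF (delta_mx j 0)))) => x Ux.
by rewrite mxE /partial derive_coord //; exact: dF.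
Qed.

(* Regularity bootstraps along D G = (D F \o G)^-1. *)
Lemma Ck_on_inverse (F G : E -> E) (U B : set E) : open U -> open B ->
  (forall k, Ck_on U k F) -> (forall x, U x -> linear_part F x \in unitmx) ->
  (forall y, B y -> U (G y)) -> (forall y, B y -> F (G y) = y) ->
  (exists c : R, forall y z, B y -> B z -> `|G y - G z| <= c * `|y - z|) ->
  forall k, Ck_on B k G.
Proof.
move=> oU oB CF uF BU FG [c cG].
have dF x : U x -> differentiable F x by have [+ _] := CF 1%N; exact.
pose M y := invmx (linear_part F (G y)).
have dG y : B y -> differentiable G y /\ 'd G y = mulmx (M y) :> (E -> E).
  move=> By; apply: differentiable_eps => [|e e0]; first exact: linear_col_continuous.
  have [a a0 aM] := mulmx_col_bound (M y).
  have c0 : 0 < `|c| + 1 by rewrite ltr_wpDl.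
  (* The remainder of [F] is at most e' |u| with |u| <= (|c| + 1) |h|, and [M y] multiplies norms by
     at most [a]; the total is e |h|. Adding 1 makes the denominator positive for every [c]. *)
  pose e' := e / (a * (`|c| + 1)).
  have e'0 : 0 < e' by rewrite divr_gt0 ?mulr_gt0.
  have [d d0 dP] := near0_ball (differentiable_near0 (dF _ (BU _ By)) e'0).
  have nB : \forall h \near (0 : E), B (h + y).
    have : \forall z \near y, B z by exact: open_nbhs_nbhs.
    by move=> /nbhs0P; apply: filterS => h; rewrite addrC.
  have q0 : 0 < d / (`|c| + 1) by rewrite divr_gt0.
  have nh : \forall h \near (0 : E), `|h| < d / (`|c| + 1).
    by apply/nbhs_norm0P; exists (d / (`|c| + 1)).
  near=> h.
  have Bh : B (h + y) by near: h.
  pose u := G (h + y) - G y.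
  have uh : `|u| <= (`|c| + 1) * `|h|.
    apply: le_trans (cG _ _ Bh By) _; rewrite addrK ler_wpM2r //.
    by rewrite (le_trans (ler_norm c)) // lerDl.
  have ud : `|u| < d.
    apply: le_lt_trans uh _; rewrite mulrC -ltr_pdivlMr //.
  have := dP u ud; rewrite /u subrK FG // FG // addrK -/u => hu.
  (* Since h = F (G (h + y)) - F (G y), the inner bracket is the first-order remainder of [F] at
     [G y] for the increment [u]. *)
  have -> : G (h + y) - G y - M y *m h = - (M y *m (h - linear_part F (G y) *m u)).
    rewrite mulmxBr mulmxA mulVmx ?mul1mx; last exact/uF/BU.
    by rewrite opprB.
  rewrite normrN; apply: le_trans (aM _) _.
  rewrite -derive_linear_part; last exact/dF/BU.
  rewrite deriveE; last exact/dF/BU.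
  apply: le_trans (ler_wpM2l (ltW a0) hu) _.
  have := ler_wpM2l (ltW (mulr_gt0 a0 e'0)) uh.
  rewrite -mulrA => /le_trans; apply.
  rewrite le_eqVlt; apply/orP; left; apply/eqP; rewrite /e'; field.
  by rewrite !gt_eqF.
have CM k : Ck_on U k (fun x => invmx (linear_part F x)).
  exact: Ck_on_invmx oU uF (Ck_on_linear_part oU (CF k.+1)).
elim=> [|k IH].
  by move=> y By; apply: differentiable_continuous; have [] := dG y By.
split=> [y By|v]; first by have [] := dG y By.
have C1 := Ck_on_mulmx oB (Ck_on_comp oB oU BU IH (CM k)) (Ck_on_cst _ _ v).
apply: (Ck_on_eq oB _ C1) => y By; have [dGy dGE] := dG y By.
by rewrite deriveE // dGE.
Unshelve. all: by end_near. Qed.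


Theorem inverse_function_germ (F : E -> E) : map_germ F ->
  (forall v, 'D_v F 0 = 0 -> v = 0) -> diffeo_germ F.
Proof.
move=> /[dup] mF [sF F0] Finj.
have dF0 := smooth_differentiable sF.
have uL0 : linear_part F 0 \in unitmx.
  by apply: unitmx_injective => v; rewrite -derive_linear_part //; exact: Finj.
pose M0 := invmx (linear_part F 0).
(* Normalised so that its derivative at 0 is the identity: x - T x then has small derivative near 0,
   and [T] is a perturbation of the identity. *)
pose T x := M0 *m F x.
have T0 : T 0 = 0 by rewrite /T F0 mulmx0.
have M0inj y z : M0 *m y = M0 *m z -> y = z.
  by move=> yz; rewrite -[y](mulKVmx uL0) -/M0 yz mulKVmx.
pose h i x : R^o := mxcoord i 0 x - T x i 0.
have sT : smooth_germ 0 T by exact: smooth_mulmx (smooth_cst _ M0) sF.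
have dT x v : differentiable F x -> 'D_v T x = M0 *m 'D_v F x.
  move=> dFx; pose L : {linear E -> E} := mulmx M0.
  have Lc : continuous L by exact: linear_col_continuous.
  exact: (derive_linear_comp v Lc dFx).
have dT' x : differentiable F x -> differentiable T x.
  move=> dFx; pose L : {linear E -> E} := mulmx M0.
  have Lc : continuous L by exact: linear_col_continuous.
  by apply: (@differentiable_comp _ _ _ _ F L) => //; exact: linear_differentiable.
have dmx i x : differentiable (@mxcoord R N 1 i 0) x.
  by apply: linear_differentiable; exact: mxcoord_continuous.
have sh i : smooth_germ 0 (h i).
  apply: smoothD; first by apply: smooth_linear; exact: mxcoord_continuous.
  exact/smoothN/smooth_coord.
have dh i x v : differentiable F x -> 'D_v (h i) x = v i 0 - (M0 *m 'D_v F x) i 0.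
  move=> dFx; rewrite deriveB; last 2 first.
  - by apply: diff_derivable; exact: dmx.
  - apply: diff_derivable.
    exact: (differentiable_comp (dT' _ dFx) (dmx i (T x))).
  rewrite (derive_coord _ _ _ (dT' x dFx)) dT //.
  by rewrite derive_linear //; exact: mxcoord_continuous.
(* N partials bounded by [e] contribute at most 1/2; [N.+1] also covers N = 0. *)
pose e : R := (2 * N.+1%:R)^-1.
have e0 : 0 < e by rewrite invr_gt0 mulr_gt0.
have Ne : N%:R * e <= 2^-1.
  rewrite /e invfM mulrCA -[leRHS]mulr1 ler_wpM2l ?invr_ge0 //.
  by rewrite ler_pdivrMr // mul1r ler_nat.
have [U [oU U0] CU] := sF.
have nU : \forall x \near (0 : E), U x by exact: open_nbhs_nbhs.
have nDij i j : \forall x \near (0 : E), `|'D_(delta_mx j 0) (h i) x| <= e.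
  have := smooth_continuous (smooth_derive (delta_mx j 0) (sh i)).
  rewrite /prop_for /continuous_at (dh _ _ _ dF0) derive_linear_part // mulmxA mulVmx //.
  rewrite mul1mx subrr => /cvgrPdist_le /(_ e e0).
  by apply: filterS => x; rewrite sub0r normrN.
have nD : \forall x \near (0 : E), forall i j, `|'D_(delta_mx j 0) (h i) x| <= e.
  have n1 i := filter_forall (nbhs_filter (0 : E)) (nDij i).
  exact: (filter_forall (nbhs_filter (0 : E)) n1).
have [r r0 rP] := near0_ball (filterI nU nD).
have dF x : `|x| < r -> differentiable F x.
  by move=> /rP[Ux _]; have [+ _] := CU 1%N; exact.
have dh' i x : `|x| < r -> differentiable (h i) x.
  move=> xr; apply: differentiableB; first exact: dmx.
  exact: (differentiable_comp (dT' _ (dF _ xr)) (dmx i (T x))).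
have Dh i x v : `|x| < r -> `|'D_v (h i) x| <= 2^-1 * `|v|.
  move=> xr; have := derive_le_partial v (dh' i x xr) (fun j => (rP x xr).2 i j).
  by move=> /le_trans; apply; rewrite ler_wpM2r.
have hL x y : `|x| < r -> `|y| < r -> `|(x - T x) - (y - T y)| <= 2^-1 * `|x - y|.
  move=> xr yr; apply: norm_col_le => [|i]; first by rewrite mulr_ge0 ?invr_ge0.
  have := lipschitz_partial (dh' i) (fun x j xr => (rP x xr).2 i j) xr yr.
  have E (a b : E) : (x - a - (y - b)) i 0 = x i 0 - a i 0 - (y i 0 - b i 0).
    by rewrite !mxE.
  rewrite E => /le_trans; apply.
  by rewrite ler_wpM2r.
(* If the derivative of [F] kills v, then that of x - T x fixes v while halving norms, so v = 0. *)
have uF x : `|x| < r -> linear_part F x \in unitmx.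
  move=> xr; apply: unitmx_injective => v.
  rewrite -derive_linear_part; last exact: dF.
  move=> Dv0; apply/eqP; rewrite -normr_le0.
  suff : `|v| <= 2^-1 * `|v| by lra.
  apply: norm_col_le => [|i]; first by rewrite mulr_ge0 ?invr_ge0.
  by have := Dh i x v xr; rewrite dh ?Dv0 ?mulmx0 ?mxE ?subr0 //; exact: dF.
have r2 : 0 < r / 2 by rewrite divr_gt0.
have ltr2 (x : E) : `|x| <= r / 2 -> `|x| < r by lra.
(* This gives uniqueness of preimages and also the Lipschitz bound on the inverse that
   [Ck_on_inverse] asks for. *)
have Tinj x y : `|x| < r -> `|y| < r -> `|x - y| <= 2 * `|T x - T y|.
  move=> xr yr; have := hL x y xr yr.
  have := ler_normD (x - T x - (y - T y)) (T x - T y).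
  have E (a b c d : E) : a - b - (c - d) + (b - d) = a - c.
    by apply/colP => i; rewrite !mxE; ring.
  rewrite E.
  lra.
(* The contraction estimate is known on the open ball of radius r; the fixed point argument needs a
   closed ball inside it, hence r / 2. *)
have surj := perturbed_identity_surjective r2 T0
  (fun (x y : E) xr yr => hL x y (ltr2 x xr) (ltr2 y yr)).
(* The default 0 is returned only where no preimage exists, hence never for |y| < r / 2 / 2. *)
pose psi y := xget 0 [set x : E | `|x| < r / 2 /\ T x = y].
have psiP y : `|y| < r / 2 / 2 -> `|psi y| < r / 2 /\ T (psi y) = y.
  move=> /surj[x xr Tx].
  by have := @xgetPex _ 0 [set x : E | `|x| < r / 2 /\ T x = y]; apply; exists x.
have psiT x : `|x| < r / 2 -> `|T x| < r / 2 / 2 -> psi (T x) = x.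
  move=> xr /psiP[pr pE]; apply/eqP; rewrite -subr_eq0 -normr_le0.
  have := Tinj (psi (T x)) x (ltr2 _ (ltW pr)) (ltr2 _ (ltW xr)).
  by rewrite pE subrr normr0 mulr0.
pose G z := psi (M0 *m z).
pose B := [set z : E | `|M0 *m z| < r / 2 / 2].
have oB : open B.
  pose L : {linear E -> E} := mulmx M0.
  have Lc : continuous L by exact: linear_col_continuous.
  apply: (@open_comp E E L [set y | `|y| < r / 2 / 2]); last exact: open_norm_lt.
  by move=> x _; exact: Lc.
have B0 : B 0 by rewrite /B /= mulmx0 normr0 divr_gt0.
have FG z : B z -> F (G z) = z.
  by move=> /psiP[_]; exact: M0inj.
have CG : forall k, Ck_on B k G.
  apply: (@Ck_on_inverse F G (U `&` [set x | `|x| < r]) B) => //.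
  - by apply: openI => //; exact: open_norm_lt.
  - by move=> k; apply: Ck_on_sub (CU k) => x [].
  - by move=> x [_]; exact: uF.
  - move=> y /psiP[yr _]; have yr' := ltr2 _ (ltW yr); split=> //.
    by case: (rP _ yr').
  have [c c0 cM] := mulmx_col_bound M0; exists (2 * c) => y z By Bz.
  have [[yr yE] [zr zE]] := (psiP _ By, psiP _ Bz).
  have := Tinj _ _ (ltr2 _ (ltW yr)) (ltr2 _ (ltW zr)).
  rewrite yE zE -mulmxBr => /le_trans; apply.
  by rewrite -mulrA ler_pM2l.
split=> //; exists G; split.
- split; first by exists B.
  by rewrite /G mulmx0 -[in LHS]T0 psiT ?T0 ?normr0 ?divr_gt0.
- have n1 : \forall x \near (0 : E), `|x| < r / 2.
    by apply/nbhs_norm0P; exists (r / 2).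
  have n2 : \forall x \near (0 : E), `|T x| < r / 2 / 2.
    have := smooth_continuous sT; rewrite /prop_for /continuous_at T0.
    move=> /cvgrPdist_lt /(_ _ (divr_gt0 r2 (ltr0n _ 2))).
    by apply: filterS => x; rewrite sub0r normrN.
  by apply: filterS2 n1 n2 => x; exact: psiT.
have nB : \forall x \near (0 : E), B x by exact: open_nbhs_nbhs.
by apply: filterS nB.
Qed.

End InverseFunction.

(** * Hadamard's lemma *)

Section Integral01.
Context {R : realType}.
Implicit Types g : R -> R.

Definition int01 g : R := \int[@lebesgue_measure R]_(s in `[0%R, 1%R]) g s.

(** Two-sided continuity, at the endpoints too: it is stable under sums and products pointwise, and
    [cont01_within] weakens it to the form that integration uses. *)
Definition cont01 g : Prop :=
  forall s : R, 0 <= s <= 1 -> {for s, continuous (g : R^o -> R^o)}.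

Lemma cont01_within g : cont01 g -> {within `[0%R, 1%R], continuous g}.
Proof.
move=> cg; apply: continuous_in_subspaceT => s.
by rewrite inE /= in_itv /= => /cg.
Qed.

Lemma cont01_integrable g : cont01 g ->
  (@lebesgue_measure R).-integrable `[0%R, 1%R] (EFin \o g).
Proof.
move=> /cont01_within cg; apply: continuous_compact_integrable => //.
exact: segment_compact.
Qed.

Lemma eq_int01 g1 g2 : (forall s, 0 <= s <= 1 -> g1 s = g2 s) ->
  int01 g1 = int01 g2.
Proof.
move=> g12; apply: eq_Rintegral => s; rewrite inE /= in_itv /=; exact: g12.
Qed.

Lemma int01D g1 g2 : cont01 g1 -> cont01 g2 ->
  int01 (fun s => g1 s + g2 s) = int01 g1 + int01 g2.
Proof. by move=> c1 c2; apply: RintegralD => //; exact: cont01_integrable. Qed.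

Lemma int01B g1 g2 : cont01 g1 -> cont01 g2 ->
  int01 (fun s => g1 s - g2 s) = int01 g1 - int01 g2.
Proof. by move=> c1 c2; apply: RintegralB => //; exact: cont01_integrable. Qed.

Lemma int01Z a g : cont01 g -> int01 (fun s => a * g s) = a * int01 g.
Proof. by move=> cg; apply: RintegralZl => //; exact: cont01_integrable. Qed.

Lemma cont01_cst a : cont01 (fun=> a).
Proof. by move=> s _; exact: cst_continuous. Qed.

Lemma cont01D g1 g2 : cont01 g1 -> cont01 g2 -> cont01 (fun s => g1 s + g2 s).
Proof. by move=> c1 c2 s s01; apply: continuousD; [exact: c1|exact: c2]. Qed.

Lemma cont01M g1 g2 : cont01 g1 -> cont01 g2 -> cont01 (fun s => g1 s * g2 s).
Proof. by move=> c1 c2 s s01; apply: continuousM; [exact: c1|exact: c2]. Qed.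

Lemma cont01X n : cont01 (fun s => s ^+ n).
Proof.
elim: n => [|n IH]; first exact: cont01_cst.
have -> : (fun s : R => s ^+ n.+1) = (fun s => s * s ^+ n).
  by apply/funext => s; rewrite exprS.
by apply: cont01M => // s _; exact: cvg_id.
Qed.

Lemma cont01_sum {I : Type} (r : seq I) (P : pred I) (g : I -> R -> R) :
  (forall i, cont01 (g i)) -> cont01 (fun s => \sum_(i <- r | P i) g i s).
Proof.
move=> cg; elim: r => [|i r IH].
  by under [X in cont01 X]eq_fun do rewrite big_nil; exact: cont01_cst.
under [X in cont01 X]eq_fun do rewrite big_cons.
by case: (P i) => //; exact: cont01D.
Qed.

Lemma int01_sum {I : Type} (r : seq I) (P : pred I) (g : I -> R -> R) :
  (forall i, cont01 (g i)) ->
  int01 (fun s => \sum_(i <- r | P i) g i s) = \sum_(i <- r | P i) int01 (g i).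
Proof.
move=> cg; elim: r => [|i r IH].
  rewrite big_nil (@eq_int01 _ (fun=> 0 * 0)); last first.
    by move=> s _; rewrite big_nil mulr0.
  by rewrite int01Z ?mul0r //; exact: cont01_cst.
rewrite big_cons -IH.
have [Pi|nPi] := boolP (P i).
  rewrite -int01D //; last exact: cont01_sum.
  by apply: eq_int01 => s _; rewrite big_cons Pi.
by apply: eq_int01 => s _; rewrite big_cons (negbTE nPi).
Qed.

Lemma int01_cst a : int01 (fun=> a) = a.
Proof.
rewrite /int01 Rintegral_cst //.
have /= := @lebesgue_measure_itv R `[0%R, 1%R]%R.
by rewrite lte_fin ltr01 oppr0 adde0 => ->; rewrite mulr1.
Qed.

Lemma int01_norm_le g c : cont01 g -> (forall s, 0 <= s <= 1 -> `|g s| <= c) ->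
  `|int01 g| <= c.
Proof.
move=> cg gc; rewrite -[leRHS]int01_cst ler_norml.
have -> : - int01 (fun=> c) = int01 (fun=> - c) by rewrite !int01_cst.
apply/andP; split; apply: le_Rintegral => //; try exact: cont01_integrable;
  try (apply: cont01_integrable; exact: cont01_cst).
- by move=> s /=; rewrite in_itv /= => /gc; rewrite ler_norml => /andP[].
- by move=> s /=; rewrite in_itv /= => /gc; rewrite ler_norml => /andP[].
Qed.

Lemma int01_FTC (F : R -> R) g : cont01 g ->
  (forall s : R, 0 <= s <= 1 -> is_derive (s : R^o) (1 : R^o) (F : R^o -> R^o) (g s)) ->
  int01 g = F 1 - F 0.
Proof.
move=> cg dF.
have cF s : 0 <= s <= 1 -> {for s, continuous F}.
  move=> /dF [/derivable1_diffP d _]; exact: differentiable_continuous d.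
rewrite /int01 /Rintegral (@continuous_FTC2 _ g F) //.
- exact: cont01_within.
- split.
  + move=> s; rewrite in_itv /= => /andP[s0 s1].
    by have [] := dF s; rewrite ?ltW.
  + by apply: cvg_at_right_filter; apply: cF; rewrite lexx ler01.
  + by apply: cvg_at_left_filter; apply: cF; rewrite lexx ler01.
- move=> s; rewrite in_itv /= => /andP[s0 s1].
  by rewrite derive1E; have [] := dF s; rewrite ?ltW.
Qed.

End Integral01.

(** * Partial dilations and differentiation under the integral sign *)

Section Scaling.
Context {R : realType} {N : nat}.
Local Notation E := 'cV[R]_N.
Variable K : pred 'I_N.

(** A homotopy from the projection that kills the coordinates in [K] (s = 0) to the identity (s =
    1); the remaining coordinates act as parameters. *)
Definition scale_coords (s : R) (w : E) : E :=
  \col_i (if K i then s * w i 0 else w i 0).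

Fact scale_coords_linear s : linear (scale_coords s).
Proof.
move=> a u v; apply/colP => i; rewrite !mxE.
by case: (K i) => //; rewrite mulrDr mulrCA.
Qed.
HB.instance Definition _ s :=
  GRing.isLinear.Build R E E _ (scale_coords s) (scale_coords_linear s).

Lemma scale_coords1 w : scale_coords 1 w = w.
Proof. by apply/colP => i; rewrite !mxE mul1r if_same. Qed.

Lemma scale_coords_norm s w : 0 <= s <= 1 -> `|scale_coords s w| <= `|w|.
Proof.
move=> /andP[s0 s1]; apply: norm_col_le => // i; rewrite mxE.
case: (K i); last exact: coord_le_norm.
rewrite normrM ger0_norm // -[leRHS]mul1r ler_pM // coord_le_norm //.
Qed.

Lemma scale_coords_continuous2 :
  continuous (fun p : R^o * E => scale_coords p.1 p.2).
Proof.
move=> p.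
apply: (@Ck_on_continuous _ _ _ setT 0 _ _ p) => //.
apply: Ck_on_mx; first exact: openT.
move=> i j q _.
have c1 : {for q, continuous (fun p : R^o * E => p.1)} by exact: cvg_fst.
have c2 : {for q, continuous (fun p : R^o * E => p.2 i 0 : R^o)}.
  by apply: (@continuous_comp _ _ _ snd (fun w : E => w i 0 : R^o)); [exact: cvg_snd|exact: coord_continuous].
case Ki: (K i).
  have -> : (fun x : R^o * E => scale_coords x.1 x.2 i j : R^o) = (fun x => x.1 * x.2 i 0).
    by apply/funext => x; rewrite mxE Ki.
  exact: continuousM.
have -> // : (fun x : R^o * E => scale_coords x.1 x.2 i j : R^o) = (fun x => x.2 i 0).
by apply/funext => x; rewrite mxE Ki.
Qed.

Lemma scale_coords_continuous1 w : continuous (fun s : R^o => scale_coords s w : E).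
Proof.
move=> s; apply: (@continuous_comp _ _ _ (fun s : R^o => (s, w)) (fun p : R^o * E => scale_coords p.1 p.2)).
  exact: (cvg_pair cvg_id (cvg_cst w)).
exact: scale_coords_continuous2.
Qed.

Lemma is_derive_scale_coords (f : E -> R^o) w (s : R) :
  differentiable f (scale_coords s w) ->
  is_derive (s : R^o) (1 : R^o) (fun s : R^o => f (scale_coords s w))
    (\sum_(i | K i) w i 0 * 'D_(delta_mx i 0) f (scale_coords s w)).
Proof.
move=> df.
pose u : E := \col_i (if K i then w i 0 else 0).
have sE : (fun s : R^o => scale_coords s w) = (fun s => s *: u + scale_coords 0 w).
  apply/funext => t; apply/colP => i; rewrite !mxE.
  by case: (K i); rewrite ?mulr0 ?mul0r ?addr0 ?add0r.
have dl : differentiable (fun s : R^o => scale_coords s w) s.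
  rewrite sE; apply: differentiableD; last exact: differentiable_cst.
  exact: ex_diff.
have Dl : 'D_1 (fun s : R^o => scale_coords s w) s = u.
  rewrite sE deriveD; last 2 first.
  - by apply: diff_derivable; exact: ex_diff.
  - exact: derivable_cst.
  rewrite derive_cst addr0 deriveE; last exact: ex_diff.
  by rewrite diff_val scale1r.
apply: DeriveDef.
  by apply: diff_derivable; exact: (differentiable_comp dl df).
have -> := derive_compose (1 : R^o) dl df.
rewrite Dl derive_partial // [LHS]big_mkcond [RHS]big_mkcond /=.
by apply: eq_bigr => i _; rewrite mxE; case: (K i); rewrite ?scale0r.
Qed.

(** Compactness of [0, 1] makes the continuity in [w] uniform in [s], which is what allows
    differentiating under the integral. Both values are compared with the one at a fixed (s, w0),
    whence e / 2. *)
Lemma scale_coords_uniform (f : E -> R^o) (r : R) (w0 : E) (e : R) :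
  (forall w, `|w| < r -> {for w, continuous f}) -> `|w0| < r -> 0 < e ->
  \forall w \near w0, forall s, 0 <= s <= 1 ->
    `|f (scale_coords s w) - f (scale_coords s w0)| <= e.
Proof.
move=> cf w0r e0.
have cov := (compact_near_coveringP _).1 (@segment_compact R 0 1).
have := cov E (nbhs w0)
  (fun w s => `|f (scale_coords s w) - f (scale_coords s w0)| <= e) (nbhs_filter w0).
move=> H; have {}H := H _.
suff Q : forall s : R, `[0%R, 1%R]%classic s -> \forall s' \near s & w \near w0,
    `|f (scale_coords s' w) - f (scale_coords s' w0)| <= e.
  by apply: filterS (H Q) => w wP s s01; apply: wP; rewrite /= in_itv.
move=> s; rewrite /= in_itv /= => s01.
have sr : `|scale_coords s w0| < r.
  by apply: le_lt_trans w0r; exact: scale_coords_norm.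
have : {for (s : R^o, w0), continuous (fun p : R^o * E => f (scale_coords p.1 p.2))}.
  apply: (@continuous_comp _ _ _ (fun p : R^o * E => scale_coords p.1 p.2) f).
    exact: scale_coords_continuous2.
  exact: cf.
move=> /cvgrPdist_lt /(_ (e / 2)); rewrite divr_gt0 // => /(_ isT).
move=> [[A B] [/= As Bw0] AB]; exists (A, B) => //= -[s' w] [/= As' Bw].
have := AB (s', w) (conj As' Bw).
have := AB (s', w0) (conj As' (nbhs_singleton Bw0)).
rewrite /= => h1 h2.
have -> : f (scale_coords s' w) - f (scale_coords s' w0) =
  (f (scale_coords s w0) - f (scale_coords s' w0)) - (f (scale_coords s w0) - f (scale_coords s' w)) by ring.
apply: le_trans (ler_normB _ _) _; lra.
Qed.

End Scaling.

Section Averaging.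
Context {R : realType} {N : nat}.
Local Notation E := 'cV[R]_N.
Implicit Types (f : E -> R^o) (K : pred 'I_N).

(* The powers of s make this family stable under differentiation:
   D_i (average K n f) = average K (n + K i) (D_i f). *)
Definition average K (n : nat) f (w : E) : R^o :=
  int01 (fun s => s ^+ n * f (scale_coords K s w)).

Definition lincomb (a : 'I_N -> R) (v : E) : R^o := \sum_i v i 0 * a i.

Fact lincomb_linear a : linear (lincomb a).
Proof.
move=> c u v; rewrite /lincomb scaler_sumr -big_split /=.
by apply: eq_bigr => i _; rewrite !mxE mulrDl -mulrA.
Qed.
HB.instance Definition _ a :=
  GRing.isLinear.Build R E R^o _ (lincomb a) (lincomb_linear a).

Lemma cont01_scale K n f r w : (forall w, `|w| < r -> {for w, continuous f}) ->
  `|w| < r -> cont01 (fun s => s ^+ n * f (scale_coords K s w)).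
Proof.
move=> cf wr; apply: cont01M; first exact: cont01X.
move=> s s01.
apply: (@continuous_comp _ _ _ (fun s : R^o => scale_coords K s w) f).
  exact: scale_coords_continuous1.
by apply: cf; apply: le_lt_trans wr; exact: scale_coords_norm.
Qed.

(** The first-order remainder of the average is the integral of the remainders for each s; the mean
    value theorem and uniform continuity of the partials bound these by e |h| simultaneously for all
    s. *)
Lemma average_differentiable K n f r (w : E) : `|w| < r ->
  (forall x, `|x| < r -> differentiable f x) ->
  (forall i x, `|x| < r -> {for x, continuous ('D_(delta_mx i 0) f)}) ->
  differentiable (average K n f) w /\
  'd (average K n f) w = lincomb (fun i => average K (n + K i)%N ('D_(delta_mx i 0) f) w)
    :> (E -> R^o).
Proof.
move=> wr df cdf.
have cf x : `|x| < r -> {for x, continuous f}.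
  by move=> /df; exact: differentiable_continuous.
apply: differentiable_eps => [|e e0]; first exact: linear_col_continuous.
(* The error is spread over the N coordinates; [N.+1] avoids dividing by zero. *)
pose e' := e / N.+1%:R.
have e'0 : 0 < e' by rewrite divr_gt0.
have n1 : \forall h \near (0 : E), `|h + w| < r.
  have : \forall x \near w, `|x| < r.
    by apply: open_nbhs_nbhs; split=> //; exact: open_norm_lt.
  by move=> /nbhs0P; apply: filterS => h; rewrite addrC.
have n2 : \forall x \near w, forall i (s : R), 0 <= s <= 1 ->
    `|'D_(delta_mx i 0) f (scale_coords K s x) - 'D_(delta_mx i 0) f (scale_coords K s w)| <= e'.
  apply: (filter_forall (nbhs_filter w)) => i.
  exact: scale_coords_uniform (cdf i) wr e'0.
have [d d0 dP] : exists2 d : R, 0 < d & forall h : E, `|h| < d -> `|h + w| < r /\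
    forall i (s : R), 0 <= s <= 1 ->
    `|'D_(delta_mx i 0) f (scale_coords K s (h + w)) - 'D_(delta_mx i 0) f (scale_coords K s w)| <= e'.
  have n2' : \forall h \near (0 : E), forall i (s : R), 0 <= s <= 1 ->
      `|'D_(delta_mx i 0) f (scale_coords K s (h + w)) - 'D_(delta_mx i 0) f (scale_coords K s w)| <= e'.
    by move: n2 => /nbhs0P; apply: filterS => h; rewrite addrC.
  exact: near0_ball (filterI n1 n2').
apply/nbhs_norm0P; exists d => // h hd.
have [hwr _] := dP h hd.
have scale_diff s (v : E) i : scale_coords K s v i 0 = s ^+ K i * v i 0.
  by rewrite mxE; case: (K i); rewrite ?expr1 ?expr0 ?mul1r.
have cD i : cont01 (fun s => s ^+ (n + K i) * 'D_(delta_mx i 0) f (scale_coords K s w)).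
  exact: cont01_scale (cdf i) wr.
have -> : average K n f (h + w) - average K n f w -
    lincomb (fun i => average K (n + K i)%N ('D_(delta_mx i 0) f) w) h =
  int01 (fun s => s ^+ n * f (scale_coords K s (h + w)) - s ^+ n * f (scale_coords K s w)
    - \sum_i h i 0 * (s ^+ (n + K i) * 'D_(delta_mx i 0) f (scale_coords K s w))).
  have c1 := @cont01_scale K n f r _ cf hwr.
  have c2 := @cont01_scale K n f r _ cf wr.
  have c3 i : cont01 (fun s => h i 0 * (s ^+ (n + K i) * 'D_(delta_mx i 0) f (scale_coords K s w))).
    by apply: cont01M (cD i); exact: cont01_cst.
  rewrite int01B; last 2 first.
  - move=> s s01; apply: continuousB; [exact: c1|exact: c2].
  - exact: cont01_sum.
  rewrite int01B // int01_sum //; congr (_ - _ - _).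
  by apply: eq_bigr => i _; rewrite int01Z.
apply: int01_norm_le.
  have c1 := @cont01_scale K n f r _ cf hwr.
  have c2 := @cont01_scale K n f r _ cf wr.
  have c3 i : cont01 (fun s => h i 0 * (s ^+ (n + K i) * 'D_(delta_mx i 0) f (scale_coords K s w))).
    by apply: cont01M (cD i); exact: cont01_cst.
  move=> s s01; apply: continuousB; last exact: (@cont01_sum R _ (index_enum _) xpredT _ c3 s s01).
  by apply: continuousB; [exact: c1|exact: c2].
move=> s s01.
have [s0 s1] := andP s01.
have sn : `|s ^+ n| <= 1 by rewrite normrX ger0_norm // exprn_ile1.
have segr t : 0 <= t <= 1 -> `|t *: h| <= `|h|.
  by move=> /andP[t0 t1]; rewrite normrZ ger0_norm // ler_piMl.
have sc_lin t : t *: scale_coords K s h + scale_coords K s w = scale_coords K s (t *: h + w).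
  by rewrite linearP.
have seg (t : R) : 0 <= t <= 1 ->
    differentiable f (t *: scale_coords K s h + scale_coords K s w).
  move=> t01; rewrite sc_lin; apply: df.
  apply: le_lt_trans (scale_coords_norm _ _ s01) _.
  by have [] := dP (t *: h) (le_lt_trans (segr t t01) hd).
(* [t] depends on [s] in an uncontrolled way, which is harmless: the mean value form only serves a
   pointwise bound, and the continuity of the integrand was obtained from its original
   expression. *)
have [t t01] := mean_value seg.
rewrite derive_partial; last exact: seg.
rewrite sc_lin -[in scale_coords K s h + _](scale1r (scale_coords K s h)) sc_lin scale1r => fE.
have -> : s ^+ n * f (scale_coords K s (h + w)) - s ^+ n * f (scale_coords K s w)
    - \sum_i h i 0 * (s ^+ (n + K i) * 'D_(delta_mx i 0) f (scale_coords K s w)) =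
  \sum_i (s ^+ n * scale_coords K s h i 0) *
    ('D_(delta_mx i 0) f (scale_coords K s (t *: h + w)) - 'D_(delta_mx i 0) f (scale_coords K s w)).
  rewrite -mulrBr fE mulr_sumr -sumrB; apply: eq_bigr => i _.
  rewrite scale_diff exprD -[X in _ * X - _]/(_ * _) mulrBr; congr (_ - _); ring.
apply: le_trans (ler_norm_sum _ _ _) _.
apply: (@le_trans _ _ (\sum_(i < N) `|h| * e')).
  apply: ler_sum => i _; rewrite normrM ler_pM //.
    rewrite normrM -[leRHS]mul1r ler_pM //.
    apply: le_trans (coord_le_norm _ _) _; exact: scale_coords_norm.
  have [_ /(_ i s s01)//] := dP (t *: h) (le_lt_trans (segr t t01) hd).
rewrite sumr_const card_ord -mulr_natl mulrCA mulrC ler_wpM2r //.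
rewrite /e' mulrCA -[leRHS]mulr1; apply: ler_wpM2l; first exact: ltW.
by rewrite ler_pdivrMr // mul1r ler_nat.
Qed.

(** All orders are assumed of [f] because even continuity of the average is drawn from its
    differentiability, which consumes a derivative of [f]. The radius stays fixed, and [n] varies in
    the induction. *)
Lemma Ck_on_average K n f r k :
  (forall k, Ck_on [set x : E | `|x| < r] k f) ->
  Ck_on [set x : E | `|x| < r] k (average K n f).
Proof.
have oB : open [set x : E | `|x| < r] by exact: open_norm_lt.
elim: k n f => [|k IH] n f Cf.
  have [df Df] := Cf 1%N.
  have cDf (i : 'I_N) := Df (delta_mx i 0).
  move=> w wr; apply: differentiable_continuous.
  by have [] := @average_differentiable K n f r w wr df cDf.
have [df Df] := Cf 1%N.
have cDf (i : 'I_N) := Df (delta_mx i 0).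
have dJ w wr := @average_differentiable K n f r w wr df cDf.
split=> [w /dJ[]//|v].
have C1 := Ck_on_sum (index_enum _) xpredT oB (fun i : 'I_N =>
  Ck_onM oB (Ck_on_cst _ _ (v i 0 : R^o)) (IH (n + K i)%N _ (fun k => (Cf k.+1).2 (delta_mx i 0)))).
apply: (Ck_on_eq oB _ C1) => w wr.
by have [dw dE] := dJ w wr; rewrite deriveE // dE.
Qed.

Lemma smooth_average K n f : smooth_germ 0 f -> smooth_germ 0 (average K n f).
Proof.
move=> [U [oU U0] CU].
have [r r0 rU] := near0_ball (open_nbhs_nbhs (conj oU U0) : \forall x \near (0 : E), U x).
exists [set x : E | `|x| < r].
  by split; [exact: open_norm_lt|rewrite /= normr0].
by move=> k; apply: Ck_on_average => {}k; exact: Ck_on_sub (CU k).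
Qed.

(** Fundamental theorem of calculus for s |-> f (scale_coords K s w) on [0, 1]. *)
Lemma hadamard K f : smooth_germ 0 f ->
  \forall w \near (0 : E), f w = f (scale_coords K 0 w) +
    \sum_(i | K i) w i 0 * average K 0 ('D_(delta_mx i 0) f) w.
Proof.
move=> [U [oU U0] CU].
have [r r0 rU] := near0_ball (open_nbhs_nbhs (conj oU U0) : \forall x \near (0 : E), U x).
apply/nbhs_norm0P; exists r => // w wr.
have sr s : 0 <= s <= 1 -> U (scale_coords K s w).
  by move=> s01; apply: rU; apply: le_lt_trans wr; exact: scale_coords_norm.
have cD i : cont01 (fun s => s ^+ 0 * 'D_(delta_mx i 0) f (scale_coords K s w)).
  have cDf x : `|x| < r -> {for x, continuous ('D_(delta_mx i 0) f)}.
    by have [_ Df] := CU 1%N => /rU Ux; exact: Df.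
  exact: (@cont01_scale K 0%N _ r _ cDf wr).
pose g s := \sum_(i | K i) w i 0 * (s ^+ 0 * 'D_(delta_mx i 0) f (scale_coords K s w)).
have cwD i : cont01 (fun s => w i 0 * (s ^+ 0 * 'D_(delta_mx i 0) f (scale_coords K s w))).
  by apply: cont01M (cD i); exact: cont01_cst.
have cg : cont01 g by apply: cont01_sum.
have FTC : int01 g = f (scale_coords K 1 w) - f (scale_coords K 0 w).
  apply: (@int01_FTC R (fun s => f (scale_coords K s w))) => // s s01.
  have [df _] := CU 1%N.
  have := @is_derive_scale_coords R N K f w s (df _ (sr s s01)).
  by rewrite /g; under [X in _ -> is_derive _ _ _ X]eq_bigr do rewrite expr0 mul1r.
apply/eqP; rewrite scale_coords1 in FTC; rewrite addrC -subr_eq -FTC /g int01_sum //.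
by apply/eqP; apply: eq_bigr => i _; rewrite int01Z.
Qed.

End Averaging.

(** * The Morse lemma with parameters *)

Section NearGerms.
Context {R : realType} {V W : normedModType R}.

Lemma near_map_germ (g : V -> W) (P : W -> Prop) : smooth_germ 0 g -> g 0 = 0 ->
  (\forall y \near (0 : W), P y) -> \forall x \near (0 : V), P (g x).
Proof.
by move=> /smooth_continuous cg g0 nP; apply: cg; rewrite g0.
Qed.

(** Lets an identity of germs be differentiated at all points near the base point. *)
Lemma near_nearS (P : V -> Prop) (x : V) : (\forall y \near x, P y) ->
  \forall y \near x, \forall z \near y, P z.
Proof. by move=> /nbhs_interior; apply: filterS. Qed.

Lemma derive_scalel (f : V -> R^o) (a : W) (v x : V) : differentiable f x ->
  'D_v (fun y => f y *: a) x = 'D_v f x *: a.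
Proof.
move=> df; have da : differentiable (fun y => f y *: a) x by exact: differentiableZl.
by rewrite deriveE // diffZl // deriveE.
Qed.

End NearGerms.

Section ParametricMorse.
Context {R : realType} {N : nat}.
Local Notation E := 'cV[R]_N.
Variable i0 : 'I_N.
Local Notation e := (delta_mx i0 0 : E).

(** Overwrites the coordinate [i0] by [g w]; written as a perturbation of the identity along [e] so
    that it can be differentiated directly. *)
Definition set_coord (g : E -> R^o) (w : E) : E := w + (g w - w i0 0) *: e.

Lemma set_coordE g w i : set_coord g w i 0 = if i == i0 then g w else w i 0.
Proof.
rewrite !mxE eqxx andbT; case: eqP => [->|_]; last by rewrite mulr0 addr0.
by rewrite mulr1 addrC subrK.
Qed.

Lemma scale0_set_coord g w :
  scale_coords (pred1 i0) 0 (set_coord g w) = scale_coords (pred1 i0) 0 w.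
Proof.
apply/colP => i; rewrite mxE [RHS]mxE set_coordE /=.
by case: eqP; rewrite ?mul0r.
Qed.

Lemma smooth_set_coord g x : smooth_germ x g -> smooth_germ x (set_coord g).
Proof.
move=> sg; apply: smooth_mx => i j; rewrite (ord1 j).
have si : smooth_germ x (fun w : E => w i 0 : R^o).
  by apply: (@smooth_linear _ _ _ _ (@mxcoord R N 1 i 0)); exact: mxcoord_continuous.
apply: (@smooth_eq _ _ _ _ (if i == i0 then g else fun w : E => w i 0)).
  by move=> w; rewrite set_coordE; case: eqP.
by case: eqP.
Qed.

Lemma derive_set_coord g x u : differentiable g x ->
  'D_u (set_coord g) x = u + ('D_u g x - u i0 0) *: e.
Proof.
move=> dg.
have dm : differentiable (@mxcoord R N 1 i0 0) x.
  by apply: linear_differentiable; exact: mxcoord_continuous.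
have db : differentiable (fun w : E => g w - mxcoord i0 0 w) x.
  exact: differentiableB.
have ds : differentiable (fun w : E => (g w - mxcoord i0 0 w) *: e) x.
  exact: differentiableZl.
have := @deriveD R E E id (fun w : E => (g w - mxcoord i0 0 w) *: e) x u
  (diff_derivable (ex_diff : differentiable id x)) (diff_derivable ds).
rewrite derive_id derive_scalel // deriveB; last 2 first.
- exact: diff_derivable.
- exact: diff_derivable.
rewrite (derive_linear u x (@mxcoord_continuous R N 1 i0 0)) => <-.
by [].
Qed.

Lemma int01_id : int01 (fun s : R => s ^+ 1) = 2^-1.
Proof.
pose F : R^o -> R^o := 2^-1 \*: (@GRing.exp R ^~ 2%N : R^o -> R^o).
have dF (s : R) : 0 <= s <= 1 -> is_derive (s : R^o) (1 : R^o) F (s ^+ 1).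
  move=> _; apply: DeriveDef; first by apply: derivableZ; exact: exprn_derivable.
  rewrite (@deriveZ _ _ _ (@GRing.exp R ^~ 2%N)); last exact: exprn_derivable.
  by rewrite exp_derive /= -[LHS]/(2^-1 * (2 * s ^+ 1 * 1)) mulr1 mulKf ?pnatr_eq0.
rewrite (int01_FTC (@cont01X R 1) dF) /F /= -[LHS]/(2^-1 * 1 ^+ 2 - 2^-1 * 0 ^+ 2).
by rewrite expr1n expr0n /= mulr0 mulr1 subr0.
Qed.

Lemma derive_coord_scale (f : E -> R^o) x c : differentiable f x ->
  'D_(c *: e) f x = c * 'D_e f x.
Proof. by move=> df; rewrite !deriveE // linearZ. Qed.

(* In the coordinate v = D_e f the germ fh = f \o Psi satisfies
   D_e fh = w_i0 * D_e zeta, so its Taylor remainder is w_i0 ^ 2 times the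
   average of D_e zeta with weight s. *)
Lemma parametric_morse (f : E -> R^o) : smooth_germ 0 f -> f 0 = 0 ->
  'D_e f 0 = 0 -> 'D_e ('D_e f) 0 != 0 ->
  exists (tau eps : E -> R^o) (s : R),
    [/\ smooth_germ 0 tau /\ smooth_germ 0 eps, s * s = 1,
        tau 0 = 0 /\ eps 0 = 0, 'D_e tau 0 != 0
      & \forall w \near (0 : E),
          f w = s * tau w ^+ 2 + eps (scale_coords (pred1 i0) 0 w)].
Proof.
move=> sf f0 v0 DDf0; pose v : E -> R^o := 'D_e f.
change (v 0 = 0) in v0; change (is_true ('D_e v 0 != 0)) in DDf0.
have sv : smooth_germ 0 v by exact: smooth_derive.
have dv := smooth_differentiable sv.
pose Phi := set_coord v.
have sPhi : smooth_germ 0 Phi by exact: smooth_set_coord.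
have Phi0 : Phi 0 = 0 by rewrite /Phi /set_coord v0 mxE subrr scale0r addr0.
have injPhi u : 'D_u Phi 0 = 0 -> u = 0.
  rewrite derive_set_coord // => Du.
  have uE : u = u i0 0 *: e.
    apply/colP => i; move/matrixP/(_ i 0): Du; rewrite !mxE eqxx andbT.
    by case: eqP => [->|_]; rewrite ?mulr1 ?mulr0 ?addr0 ?mulr0.
  have : 'D_u v 0 = 0.
    move/matrixP/(_ i0 0): Du; rewrite !mxE !eqxx mulr1 addrC subrK.
    exact.
  rewrite uE derive_coord_scale // => /eqP.
  by rewrite mulf_eq0 (negbTE DDf0) orbF => /eqP ->; rewrite scale0r.
have [_ [Psi [[sPsi Psi0] PsiPhi PhiPsi]]] := inverse_function_germ (conj sPhi Phi0) injPhi.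
pose zeta (w : E) : R^o := Psi w i0 0.
have sz : smooth_germ 0 zeta by exact: smooth_coord.
(* [Phi] alters the coordinate [i0] alone, so its inverse does too and is determined by [zeta]. *)
have PsiE : \forall w \near (0 : E), Psi w = set_coord zeta w.
  apply: filterS PhiPsi => w wE; apply/colP => i; rewrite set_coordE.
  by case: eqP => [->//|/eqP/negbTE ii0]; rewrite -[in RHS]wE set_coordE ii0.
have vPsi : \forall w \near (0 : E), v (Psi w) = w i0 0.
  by apply: filterS PhiPsi => w wE; rewrite -[in RHS]wE set_coordE eqxx.
have dz := smooth_near_differentiable sz.
have DPsi : \forall w \near (0 : E), 'D_e Psi w = 'D_e zeta w *: e.
  apply: filterS2 (near_nearS PsiE) dz => w PsiEw dzw.
  rewrite (near_eq_derive _ PsiEw) derive_set_coord // mxE !eqxx.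
  by rewrite scalerBl scale1r addrC subrK.
(* [v \o Psi] is the coordinate [i0]; differentiating it gives D_e zeta (0) * D_e v (0) = 1. *)
have Dz0 : 'D_e zeta 0 != 0.
  have Dv0 : 'D_e (v \o Psi) 0 = 1.
    rewrite (near_eq_derive _ (_ : \forall w \near 0, (v \o Psi) w = mxcoord i0 0 w)) //.
    rewrite (derive_linear e 0 (@mxcoord_continuous R N 1 i0 0)).
    by rewrite -[LHS]/((delta_mx i0 0 : E) i0 0) mxE !eqxx.
  move: Dv0; rewrite derive_compose ?Psi0 //; last exact: smooth_differentiable.
  rewrite (nbhs_singleton DPsi) derive_coord_scale //.
  by apply: contra_eq_neq => ->; rewrite mul0r eq_sym oner_neq0.
pose fh := f \o Psi.
have sfh : smooth_germ 0 fh by apply: smooth_comp => //; rewrite Psi0.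
have Dfh : \forall w \near (0 : E), 'D_e fh w = w i0 0 * 'D_e zeta w.
  have dPsi := smooth_near_differentiable sPsi.
  have df := near_map_germ sPsi Psi0 (smooth_near_differentiable sf).
  apply: filterS2 (filterI dPsi df) (filterI DPsi vPsi) => w [dPw dfw] [DPw vPw].
  by rewrite derive_compose // DPw derive_coord_scale // -[X in _ * X = _]/(v (Psi w)) vPw mulrC.
pose beta := average (pred1 i0) 1 ('D_e zeta).
have sbeta : smooth_germ 0 beta by apply: smooth_average; exact: smooth_derive.
have beta0 : beta 0 != 0.
  have -> : beta 0 = 'D_e zeta 0 * 2^-1.
    rewrite -int01_id -int01Z; last exact: cont01X.
    by apply: eq_int01 => s _; rewrite linear0 mulrC.
  by rewrite mulf_neq0 // invr_neq0.
have fhE : \forall w \near (0 : E),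
    fh w = fh (scale_coords (pred1 i0) 0 w) + w i0 0 ^+ 2 * beta w.
  have [r r0 rP] := near0_ball (filterI Dfh (smooth_near_differentiable (smooth_derive e sz))).
  have nr : \forall w \near (0 : E), `|w| < r by apply/nbhs_norm0P; exists r.
  apply: filterS2 nr (hadamard (pred1 i0) sfh) => w wr ->; congr (_ + _).
  rewrite big_pred1_eq expr2 -mulrA; congr (_ * _).
  rewrite /beta /average -int01Z; last first.
    have cDz x : `|x| < r -> {for x, continuous ('D_e zeta)}.
      by move=> /rP[_]; exact: differentiable_continuous.
    exact: (@cont01_scale R N (pred1 i0) 1 _ r _ cDz wr).
  apply: eq_int01 => s s01.
  have [-> _] := rP _ (le_lt_trans (scale_coords_norm (pred1 i0) w s01) wr).
  by rewrite mxE /= eqxx; ring.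
(* With this sign s * beta is positive near 0, so its square root is smooth. *)
pose s : R := Num.sg (beta 0).
have ss : s * s = 1 by rewrite -expr2 sqr_sg beta0.
pose tau w : R^o := v w * Num.sqrt (s * beta (Phi w)).
have sbPhi : smooth_germ 0 (fun w => s * beta (Phi w) : R^o).
  apply: (@smoothM _ _ _ (cst (s : R^o))); first exact: smooth_cst.
  by apply: (smooth_comp sPhi); rewrite Phi0.
have sb0 : 0 < s * beta 0 by rewrite -normrEsg normr_gt0.
have ssq : smooth_germ 0 (fun w => Num.sqrt (s * beta (Phi w)) : R^o).
  have sb0' : 0 < s * beta (Phi 0) by rewrite Phi0.
  exact: (@smooth_sqrt R E 0 (fun w => s * beta (Phi w) : R^o) sb0' sbPhi).
(* The remainder is [fh] itself: f = fh o Phi, and killing the coordinate [i0] after [Phi] is the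
   same as killing it in w. *)
exists tau, fh, s; split=> //.
- by split=> //; exact: smoothM.
- by rewrite /tau v0 mul0r /fh /= Psi0 f0.
- rewrite /tau deriveM; last 2 first.
  + by apply: diff_derivable.
  + by apply: diff_derivable; exact: smooth_differentiable.
  rewrite v0 scale0r add0r -[X in X != 0]/(_ * _) mulf_neq0 //.
  by rewrite gt_eqF // sqrtr_gt0 Phi0.
have nb : \forall w \near (0 : E), 0 < s * beta (Phi w).
  have := smooth_continuous sbPhi; rewrite /prop_for /continuous_at Phi0.
  move/cvgrPdist_lt => /(_ (s * beta 0) sb0).
  by apply: filterS => y /ltr_normlW; rewrite ltrBlDr ltrDl.
apply: filterS2 (filterI nb PsiPhi) (near_map_germ sPhi Phi0 fhE) => w [bw PPw].
rewrite {1}/fh /= PPw => ->.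
rewrite scale0_set_coord addrC set_coordE eqxx /tau exprMn sqr_sqrtr; last exact: ltW.
congr (_ + _); rewrite mulrCA [s * (s * _)]mulrA ss mul1r; reflexivity.
Qed.

End ParametricMorse.

(** * Normal form of deformations of corank-one germs *)

Section ColumnBlocks.
Context {R : realType} {V : normedModType R}.

Lemma smooth_col_mx {p q : nat} x (f : V -> 'cV[R]_p) (g : V -> 'cV[R]_q) :
  smooth_germ x f -> smooth_germ x g -> smooth_germ x (fun y => col_mx (f y) (g y)).
Proof.
move=> sf sg; apply: smooth_mx => i j; rewrite (ord1 j).
case: (split_ordP i) => l ->.
  by apply: smooth_eq (smooth_coord l 0 sf) => y; rewrite col_mxEu.
by apply: smooth_eq (smooth_coord l 0 sg) => y; rewrite col_mxEd.
Qed.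

Lemma derive_col_mx {p q : nat} v x (f : V -> 'cV[R]_p) (g : V -> 'cV[R]_q) :
  smooth_germ x f -> smooth_germ x g ->
  'D_v (fun y => col_mx (f y) (g y)) x = col_mx ('D_v f x) ('D_v g x).
Proof.
move=> sf sg; have dfg := smooth_differentiable (smooth_col_mx sf sg).
apply/colP => i; rewrite -(derive_coord _ _ _ dfg).
case: (split_ordP i) => l ->.
  rewrite col_mxEu -(derive_coord _ _ _ (smooth_differentiable sf)).
  by congr ('D_v _ x); apply/funext => y; rewrite col_mxEu.
rewrite col_mxEd -(derive_coord _ _ _ (smooth_differentiable sg)).
by congr ('D_v _ x); apply/funext => y; rewrite col_mxEd.
Qed.

(** Acceleration and velocity terms are kept apart: when the first derivative of [g] vanishes on the
    acceleration, the second derivative sees only the velocity of [psi]. *)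
Lemma derive2_comp {N : nat} (g : 'cV[R]_N -> R^o) (psi : V -> 'cV[R]_N) x e :
  smooth_germ x psi -> smooth_germ (psi x) g ->
  'D_e ('D_e (g \o psi)) x =
    'D_('D_e ('D_e psi) x) g (psi x) + 'D_('D_e psi x) ('D_('D_e psi x) g) (psi x).
Proof.
move=> spsi sg.
have dpsi := smooth_near_differentiable spsi.
have dg : \forall y \near x, differentiable g (psi y).
  exact: (smooth_continuous spsi) (smooth_near_differentiable sg).
have D1 : \forall y \near x, 'D_e (g \o psi) y =
    \sum_i 'D_e psi y i 0 * 'D_(delta_mx i 0) g (psi y).
  by apply: filterS2 dpsi dg => y dpy dgy; rewrite derive_compose // derive_partial.
rewrite (near_eq_derive _ D1).
pose F i := (fun y => 'D_e psi y i 0 : R^o).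
pose H i := ('D_(delta_mx i 0) g \o psi : V -> R^o).
have sF i : smooth_germ x (F i) by exact: smooth_coord (smooth_derive e spsi).
have sH i : smooth_germ x (H i) by exact: smooth_comp spsi (smooth_derive _ sg).
have dF i := diff_derivable (v := e) (smooth_differentiable (sF i)).
have dH i := diff_derivable (v := e) (smooth_differentiable (sH i)).
have -> : 'D_e (fun y => \sum_i 'D_e psi y i 0 * 'D_(delta_mx i 0) g (psi y)) x =
  \sum_i (F i x * 'D_e (H i) x + H i x * 'D_e (F i) x).
  have -> : (fun y => \sum_i 'D_e psi y i 0 * 'D_(delta_mx i 0) g (psi y)) =
      \sum_i (F i * H i).
    by apply/funext => y; rewrite fct_sumE; apply: eq_bigr.
  rewrite derive_sum => [|i]; last exact: derivableM.
  by apply: eq_bigr => i _; rewrite deriveM.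
rewrite big_split addrC; congr (_ + _); last first.
  rewrite [RHS](derive_partial _ (smooth_differentiable sg)).
  apply: eq_bigr => i _; rewrite mulrC derive_coord //.
  exact/smooth_differentiable/smooth_derive.
have Da : \forall y \near psi x, 'D_('D_e psi x) g y =
    \sum_i 'D_e psi x i 0 * 'D_(delta_mx i 0) g y.
  by apply: filterS (smooth_near_differentiable sg) => y dgy; rewrite derive_partial.
rewrite (near_eq_derive _ Da).
pose L i := ('D_(delta_mx i 0) g : 'cV[R]_N -> R^o).
have dL i : differentiable (L i) (psi x) by exact/smooth_differentiable/smooth_derive.
have -> : (fun y => \sum_i 'D_e psi x i 0 * 'D_(delta_mx i 0) g y) =
    \sum_i ('D_e psi x i 0 \*: L i).
  by apply/funext => y; rewrite fct_sumE; apply: eq_bigr.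
rewrite derive_sum => [|i]; last by apply: derivableZ; exact: diff_derivable.
apply: eq_bigr => i _; rewrite deriveZ; last exact: diff_derivable.
congr (_ * _); by rewrite (derive_compose e (smooth_differentiable spsi) (dL i)).
Qed.

End ColumnBlocks.

Section Splitting.
Context {R : realType} {d k : nat}.
Local Notation E := 'cV[R]_(d + 1).
Local Notation N := (d + 1 + k)%N.
Local Notation zI := (rshift d 0 : 'I_(d + 1)).

(** Inclusion of the slice mu = 0, the only place where a deformation is prescribed. *)
Definition pad0 (x : E) : 'cV[R]_N := col_mx x 0.

Fact pad0_linear : linear pad0.
Proof. by move=> a x y; rewrite /pad0 scale_col_mx add_col_mx scaler0 addr0. Qed.
HB.instance Definition _ := GRing.isLinear.Build R E 'cV[R]_N _ pad0 pad0_linear.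

Definition low (i : 'I_N) : bool := (i < d)%N.

Lemma scale0_low (u : 'cV[R]_d) (z : 'cV[R]_1) (m : 'cV[R]_k) :
  scale_coords low 0 (col_mx (col_mx u z) m) = col_mx (col_mx 0 z) m.
Proof.
apply/colP => i; rewrite mxE mul0r; case: (split_ordP i) => j ->.
  rewrite !col_mxEu; case: (split_ordP j) => l ->.
    by rewrite /low /= ltn_ord col_mxEu mxE.
  by rewrite /low /= ltnNge leq_addr !col_mxEd.
by rewrite /low /= !col_mxEd ltnNge -addnA leq_addr.
Qed.

Lemma sum_low (F : 'I_N -> R) :
  \sum_(i | low i) F i = \sum_(i < d) F (lshift k (lshift 1 i)).
Proof.
rewrite big_mkcond big_split_ord /= [X in _ + X]big1 ?addr0; last first.
  by move=> i _; rewrite /low /= ltnNge -addnA leq_addr.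
rewrite big_split_ord /= [X in _ + X]big1 ?addr0; last first.
  by move=> i _; rewrite /low /= ltnNge leq_addr.
by apply: eq_bigr => i _; rewrite /low /= ltn_ord.
Qed.

Variables (G : 'cV[R]_N -> E) (xi : E).
Hypotheses (sG : smooth_germ 0 G) (G0 : G 0 = 0).

Let fy w : 'cV[R]_d := usubmx (G w).
Let g w : R^o := G w zI 0.

Hypothesis fy_inj : forall y : 'cV[R]_d,
  'D_(pad0 (col_mx y 0)) fy 0 = 0 -> y = 0.
Hypothesis Dg0 : forall x, 'D_(pad0 x) g 0 = 0.
Hypothesis xi1 : dsubmx xi = 1%:M.
Hypothesis Dxi : 'D_(pad0 xi) fy 0 = 0.
Hypothesis DDg : 'D_(pad0 xi) ('D_(pad0 xi) g) 0 != 0.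

(** Accordingly all hypotheses concern derivatives along the slice mu = 0. The last conclusion says
    that (fy, tau) is immersive on that slice, so the inverse function theorem makes it a coordinate
    system there. *)
Theorem corank1_splitting :
  exists (c : 'I_d -> 'cV[R]_N -> R^o) (tau : 'cV[R]_N -> R^o)
      (eps : 'cV[R]_k -> R^o) (s : R),
    [/\ [/\ forall i, smooth_germ 0 (c i), smooth_germ 0 tau & smooth_germ 0 eps],
        [/\ s * s = 1, tau 0 = 0 & eps 0 = 0],
        \forall w \near (0 : 'cV[R]_N), g w =
          \sum_i fy w i 0 * c i w + s * tau w ^+ 2 + eps (dsubmx w)
      & forall x, 'D_(pad0 x) fy 0 = 0 -> 'D_(pad0 x) tau 0 = 0 -> x = 0].
Proof.
pose Lfy : {linear E -> 'cV[R]_d} := usubmx.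
pose mu : {linear 'cV[R]_N -> 'cV[R]_k} := dsubmx.
pose zc : {linear 'cV[R]_N -> 'cV[R]_1} := dsubmx \o (usubmx : 'cV[R]_N -> E).
have Lfy_cont : continuous Lfy by exact: linear_col_continuous.
have mu_cont : continuous mu by exact: linear_col_continuous.
have zc_cont : continuous zc by exact: linear_col_continuous.
have sfy : smooth_germ 0 fy by exact: (smooth_linear_comp Lfy_cont sG).
have sg : smooth_germ 0 g by exact: smooth_coord.
have smu x : smooth_germ x mu by exact: smooth_linear.
have szc x : smooth_germ x zc by exact: smooth_linear.
have Dmu u x : 'D_u mu x = mu u by exact: derive_linear.
have Dzc u x : 'D_u zc x = zc u by exact: derive_linear.
have zcE w : zc w = dsubmx (usubmx w) by [].
have muE w : mu w = dsubmx w by [].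
pose Phi w := col_mx (col_mx (fy w) (zc w)) (mu w).
have sPhi : smooth_germ 0 Phi by do 2?[apply: smooth_col_mx => //].
have Phi0 : Phi 0 = 0.
  by rewrite /Phi /fy G0 /zc /mu !linear0 !col_mx0.
have DPhi u : 'D_u Phi 0 = col_mx (col_mx ('D_u fy 0) (zc u)) (mu u).
  by rewrite derive_col_mx ?Dmu ?derive_col_mx ?Dzc //; exact: smooth_col_mx.
(* A kernel vector has zero z and mu components, so it has the form handled by [fy_inj]. *)
have PhiInj u : 'D_u Phi 0 = 0 -> u = 0.
  move=> /eqP; rewrite DPhi !col_mx_eq0 => /andP[/andP[/eqP Dfu /eqP zu] /eqP mu0].
  have [y uE] : exists y, u = pad0 (col_mx y 0).
    exists (usubmx (usubmx u)).
    by rewrite /pad0 -[LHS]vsubmxK -/(mu u) mu0 -zu vsubmxK.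
  have Dfy : 'D_(pad0 (col_mx y 0)) fy 0 = 0 by rewrite -uE.
  have y0 : y = 0 by exact: fy_inj Dfy.
  by rewrite uE y0 /pad0 !col_mx0.
have [_ [Psi [[sPsi Psi0] PsiPhi PhiPsi]]] := inverse_function_germ (conj sPhi Phi0) PhiInj.
pose e : 'cV[R]_N := delta_mx (lshift k zI) 0.
have eE : e = col_mx (col_mx 0 1%:M) 0.
  apply/colP => i; rewrite mxE eqxx andbT; case: (split_ordP i) => j ->.
    rewrite col_mxEu (inj_eq (@lshift_inj _ _)); case: (split_ordP j) => l ->.
      by rewrite col_mxEu mxE eq_lrshift.
    by rewrite col_mxEd (ord1 l) !mxE eqxx.
  by rewrite col_mxEd mxE eq_rlshift.
(* [xi] is killed by the derivative of [fy] and has z-component 1, so the derivative of [Phi] sends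
   it to [e]. *)
have DPsi : 'D_e Psi 0 = pad0 xi.
  have Dxi' : 'D_(pad0 xi) Phi 0 = e.
    by rewrite DPhi Dxi zcE muE /pad0 col_mxKu col_mxKd xi1 eE.
  have dPsi : differentiable Psi (Phi 0) by rewrite Phi0; exact: smooth_differentiable.
  have := derive_compose (pad0 xi) (smooth_differentiable sPhi) dPsi.
  by rewrite Dxi' Phi0 (near_eq_derive _ PsiPhi) derive_id => <-.
pose g' := g \o Psi.
have sg' : smooth_germ 0 g' by apply: smooth_comp => //; rewrite Psi0.
have g'0 : g' 0 = 0 by rewrite /g' /= Psi0 /g G0 mxE.
have Dg'0 : 'D_e g' 0 = 0.
  rewrite derive_compose ?DPsi ?Psi0 //; exact: smooth_differentiable.
(* [Psi] preserves mu, so its acceleration lies in the slice, where [Dg0] cancels its contribution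
   to the second derivative of [g']. *)
have DDPsi : exists x, 'D_e ('D_e Psi) 0 = pad0 x.
  exists (usubmx ('D_e ('D_e Psi) 0)).
  rewrite /pad0 -[LHS]vsubmxK; congr col_mx.
  have muPsi : \forall w \near (0 : 'cV[R]_N), (mu \o Psi) w = mu w.
    by apply: filterS PhiPsi => w wE; rewrite -[in RHS]wE muE col_mxKd.
  have DmuPsi : \forall w \near (0 : 'cV[R]_N), mu ('D_e Psi w) = 0.
    apply: filterS2 (near_nearS muPsi) (smooth_near_differentiable sPsi) => w wE dPw.
    have := derive_linear_comp e mu_cont dPw.
    rewrite -/mu => <-; rewrite (near_eq_derive _ wE) Dmu.
    by rewrite muE eE col_mxKd.
  have := derive_linear_comp e mu_cont
    (smooth_differentiable (smooth_derive e sPsi)).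
  move=> <-; rewrite (near_eq_derive _ (_ : \forall w \near 0, _ w = cst 0 w)) ?derive_cst //.
have DDg' : 'D_e ('D_e g') 0 != 0.
  have [x xE] := DDPsi.
  by rewrite derive2_comp ?Psi0 // xE Dg0 add0r DPsi.
pose kill := scale_coords low 0 : 'cV[R]_N -> 'cV[R]_N.
have kill_cont : continuous kill by exact: linear_col_continuous.
have kille : kill e = e by rewrite eE /kill scale0_low.
have kill0 : kill 0 = 0 by exact: linear0.
(* This is gamma (z, mu), viewed as a germ on the whole space so that the Morse lemma applies to
   it. *)
pose F := g' \o kill.
have sF : smooth_germ 0 F by apply: smooth_comp_linear => //; rewrite linear0.
have Dkill (h : 'cV[R]_N -> R^o) : 'D_e (h \o kill) = 'D_e h \o kill.
  apply/funext => w; have := derive_comp_linear h (scale_coords low 0) e w.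
  by rewrite -[X in 'D_X h _]/(kill e) kille.
have DF : 'D_e F = 'D_e g' \o kill by exact: Dkill.
have F0 : F 0 = 0 by rewrite /F /= kill0.
have Dkill_at (h : 'cV[R]_N -> R^o) w : 'D_e (h \o kill) w = 'D_e h (kill w).
  by have /(congr1 (@^~ w)) := Dkill h.
have DF0 : 'D_e F 0 = 0 by rewrite Dkill_at kill0.
have DDF0 : 'D_e ('D_e F) 0 != 0.
  by rewrite DF Dkill_at kill0.
have [tau' [eps' [s [[stau' seps'] ss [tau'0 eps'0] Dtau' FE]]]] :=
  parametric_morse sF F0 DF0 DDF0.
pose c i := average low 0 ('D_(delta_mx (lshift k (lshift 1 i)) 0) g') \o Phi : _ -> R^o.
pose tau := tau' \o (kill \o Phi) : _ -> R^o.
(* The argument of [eps'] has f = 0 from [kill] and z = 0 from the Morse lemma, so only mu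
   remains. *)
pose eps (m : 'cV[R]_k) : R^o := eps' (col_mx 0 m).
have skP : smooth_germ 0 (kill \o Phi) by exact: smooth_linear_comp.
have kP0 : (kill \o Phi) 0 = 0 by rewrite /= Phi0 kill0.
exists c, tau, eps, s; split.
- split=> [i||].
  + apply: smooth_comp => //; rewrite Phi0; apply: smooth_average.
    exact: smooth_derive.
  + by apply: smooth_comp => //; rewrite kP0.
  + apply: (@smooth_comp _ _ _ _ (fun m => col_mx 0 m)).
      apply: smooth_col_mx; [exact: smooth_cst|exact: smooth_id].
    by rewrite col_mx0.
- by split=> //; rewrite /tau /eps ?col_mx0 //= -[kill _]/((kill \o Phi) 0) kP0.
- have n1 := near_map_germ sPhi Phi0 (hadamard low sg').
  have n2 := near_map_germ skP kP0 FE.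
  apply: filterS2 (filterI n1 n2) PsiPhi => w [h1 h2] PPw.
  rewrite -[g w]/(g w) -[in LHS]PPw -[LHS]/(g' (Phi w)) h1 addrC sum_low -addrA.
  congr (_ + _).
    by apply: eq_bigr => i _; rewrite !col_mxEu.
  have -> : g' (scale_coords low 0 (Phi w)) = F ((kill \o Phi) w).
    by rewrite /F /= /kill /Phi !scale0_low.
  rewrite h2; congr (_ + eps' _); rewrite /= /kill /Phi scale0_low.
  apply/colP => i; rewrite mxE mul0r /=; case: (split_ordP i) => j ->.
    rewrite (inj_eq (@lshift_inj _ _)) !col_mxEu; case: (split_ordP j) => l ->.
      by rewrite eq_lrshift col_mxEu !mxE.
    by rewrite (ord1 l) eqxx mxE.
  by rewrite eq_rlshift !col_mxEd.
move=> x Dfx Dtx.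
(* Once the derivative of [fy] vanishes, only the z-component of [x] survives; as D_e tau' is
   nonzero it must vanish too, and [fy_inj] handles the rest. *)
have DkP : 'D_(pad0 x) (kill \o Phi) 0 = dsubmx x 0 0 *: e.
  rewrite (derive_linear_comp _ kill_cont (smooth_differentiable sPhi)) DPhi Dfx.
  rewrite -[LHS]/(scale_coords low 0 _) scale0_low zcE muE /pad0 col_mxKu col_mxKd eE.
  rewrite !scale_col_mx !scaler0; congr (col_mx (col_mx _ _) _).
  by apply/colP => i; rewrite (ord1 i) !mxE eqxx mulr1.
have x1 : dsubmx x = 0.
  apply/colP => i; rewrite (ord1 i) [RHS]mxE.
  have dtau : differentiable tau' ((kill \o Phi) 0).
    by rewrite kP0; exact: smooth_differentiable.
  move: Dtx; rewrite /tau (derive_compose _ (smooth_differentiable skP) dtau).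
  rewrite DkP kP0 derive_coord_scale; last exact: smooth_differentiable.
  by move/eqP; rewrite mulf_eq0 (negbTE Dtau') orbF => /eqP.
move: Dfx; rewrite -[x]vsubmxK x1 => /fy_inj ->.
by rewrite col_mx0.
Qed.

End Splitting.

Section PairColumns.
Context {R : realType} {m k : nat}.

(** Deformations live on a product space, the inverse function theorem on columns; [split_col] and
    [join_col] translate between them. *)
Definition split_col (w : 'cV[R]_(m + k)) : 'cV[R]_m * 'cV[R]_k :=
  (usubmx w, dsubmx w).

Fact split_col_linear : linear split_col.
Proof. by move=> a x y; rewrite /split_col !linearP. Qed.
HB.instance Definition _ :=
  GRing.isLinear.Build R 'cV[R]_(m + k) ('cV[R]_m * 'cV[R]_k)%type _
    split_col split_col_linear.

Definition join_col (w : 'cV[R]_m * 'cV[R]_k) : 'cV[R]_(m + k) := col_mx w.1 w.2.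

Lemma join_col0 : join_col 0 = 0.
Proof. exact: col_mx0. Qed.

Lemma smooth_join_col x : smooth_germ x join_col.
Proof.
apply: smooth_col_mx.
  pose L : {linear ('cV[R]_m * 'cV[R]_k)%type -> 'cV[R]_m} := fst.
  by apply: (@smooth_linear _ _ _ x L) => y; exact: cvg_fst.
pose L : {linear ('cV[R]_m * 'cV[R]_k)%type -> 'cV[R]_k} := snd.
by apply: (@smooth_linear _ _ _ x L) => y; exact: cvg_snd.
Qed.

End PairColumns.

Section Corank1.
Context {R : realType} {d : nat}.
Local Notation E := 'cV[R]_(d + 1).
Local Notation zI := (rshift d 0 : 'I_(d + 1)).

Variables (X : E -> E) (xi : E).
Hypothesis mX : map_germ X.
Let Xy x : 'cV[R]_d := usubmx (X x).
Let Xz x : R^o := X x zI 0.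
Hypothesis Xy_inj : forall y : 'cV[R]_d, 'D_(col_mx y 0) Xy 0 = 0 -> y = 0.
Hypothesis DXz : forall x, 'D_x Xz 0 = 0.
Hypothesis xi1 : dsubmx xi = 1%:M.
Hypothesis DXy_xi : 'D_xi Xy 0 = 0.
Hypothesis DDXz : 'D_xi ('D_xi Xz) 0 != 0.

Definition reduced (tau : E -> R^o) (x : E) : E :=
  col_mx (Xy x) (const_mx (tau x)).

(** One normal form serves both germs: at mu = 0 the displayed identity becomes that of [X], with
    the same c, tau and s. [psi] inverts the coordinates (Xy, tau) of the slice. *)
Lemma corank1_normal_form (k : nat) (G : 'cV[R]_k -> E -> E) : deformation X G ->
  exists (c : 'I_d -> 'cV[R]_(d + 1 + k) -> R^o) (tau : 'cV[R]_(d + 1 + k) -> R^o)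
      (eps : 'cV[R]_k -> R^o) (s : R) (psi : E -> E),
    [/\ [/\ forall i, smooth_germ 0 (c i), smooth_germ 0 tau & smooth_germ 0 eps],
        [/\ s * s = 1, tau 0 = 0 & eps 0 = 0],
        \forall w \near (0 : 'cV[R]_(d + 1 + k)), G (dsubmx w) (usubmx w) zI 0 =
          \sum_i usubmx (G (dsubmx w) (usubmx w)) i 0 * c i w + s * tau w ^+ 2
            + eps (dsubmx w),
        map_germ psi /\ map_germ (reduced (tau \o pad0))
      & (\forall x \near (0 : E), psi (reduced (tau \o pad0) x) = x) /\
        (\forall x \near (0 : E), reduced (tau \o pad0) (psi x) = x)].
Proof.
move=> [sG GX]; have [sX X0] := mX.
pose G' w := G (dsubmx w) (usubmx w).
have split_cont : continuous (split_col : 'cV[R]_(d + 1 + k) -> _).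
  exact: linear_col_continuous.
have pad_cont : continuous (pad0 : E -> 'cV[R]_(d + 1 + k)).
  exact: linear_col_continuous.
have sG' : smooth_germ 0 G'.
  have sG0 : smooth_germ (split_col 0) (fun w => G w.2 w.1) by rewrite linear0.
  exact: (smooth_comp_linear split_cont sG0).
have GE x : G' (pad0 x) = G 0 x by rewrite /G' /pad0 col_mxKu col_mxKd.
have G0 : G' 0 = 0.
  by rewrite -[0]/(0 : 'cV[R]_(d + 1 + k)) -(linear0 pad0) GE (nbhs_singleton GX).
pose Lu : {linear E -> 'cV[R]_d} := usubmx.
have Lu_cont : continuous Lu by exact: linear_col_continuous.
have sXy : smooth_germ 0 Xy by exact: (smooth_linear_comp Lu_cont sX).
have DGy x : 'D_(pad0 x) (fun w => usubmx (G' w)) 0 = 'D_x Xy 0.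
  have := derive_comp_linear (fun w => usubmx (G' w)) pad0 x 0.
  rewrite linear0 => <-; apply: near_eq_derive.
  by apply: filterS GX => y yE; rewrite /= GE yE.
pose g w : R^o := G' w zI 0.
have gX : \forall x \near (0 : E), g (pad0 x) = Xz x.
  by apply: filterS GX => x xE; rewrite /g GE xE.
have DGz x y : 'D_(pad0 x) g (pad0 y) = 'D_x (g \o pad0) y.
  by rewrite derive_comp_linear.
have [||||| c [tau [eps [s [sc st gE tau_inj]]]]] :=
  @corank1_splitting R d k G' xi sG' G0.
- by move=> y; rewrite DGy; exact: Xy_inj.
- move=> x; have := DGz x 0; rewrite linear0 => ->.
  by rewrite (near_eq_derive _ gX) DXz.
- exact: xi1.
- by rewrite DGy.
- have := derive_comp_linear ('D_(pad0 xi) g) pad0 xi 0; rewrite linear0 => <-.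
  (* For second derivatives the first derivatives must agree on a whole neighbourhood in the slice,
     not just at 0. *)
  rewrite (near_eq_derive _ (_ : \forall x \near 0, _ x = 'D_xi Xz x)) //.
  by apply: filterS (near_nearS gX) => x xE; rewrite /= DGz; exact: near_eq_derive.
have [_ stau _] := sc; have [_ tau0 _] := st.
have stp : smooth_germ 0 (tau \o pad0).
  by apply: smooth_comp_linear => //; rewrite linear0.
have sc1 : smooth_germ 0 (fun x => const_mx ((tau \o pad0) x) : 'cV[R]_1).
  by apply: smooth_mx => i j; apply: smooth_eq stp => x; rewrite mxE.
have sr : smooth_germ 0 (reduced (tau \o pad0)) by exact: smooth_col_mx.
have r0 : reduced (tau \o pad0) 0 = 0.
  have p0 : pad0 (0 : E) = 0 :> 'cV[R]_(d + 1 + k) by exact: linear0.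
  rewrite /reduced /Xy X0 /= p0 tau0.
  by apply/colP => i; case: (split_ordP i) => j ->; rewrite ?col_mxEu ?col_mxEd !mxE.
have rinj v : 'D_v (reduced (tau \o pad0)) 0 = 0 -> v = 0.
  rewrite derive_col_mx // => /eqP; rewrite col_mx_eq0 => /andP[/eqP Dy /eqP Dt].
  apply: tau_inj; first by rewrite DGy.
  have := derive_comp_linear tau pad0 v 0; rewrite linear0 => <-.
  move/matrixP/(_ 0 0): Dt; rewrite -derive_coord; last exact: smooth_differentiable.
  rewrite mxE => <-; congr ('D_v _ 0); apply/funext => x; by rewrite mxE.
have [_ [psi [mpsi psiK rK]]] := inverse_function_germ (conj sr r0) rinj.
by exists c, tau, eps, s, psi.
Qed.

End Corank1.

Section SmoothBlock.
Context {R : realType} {V : normedModType R}.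

Lemma smooth_lower_block {p q : nat} x (f : V -> 'M[R]_(q, p)) (b : 'M[R]_q) :
  smooth_germ x f ->
  smooth_germ x (fun y => block_mx 1%:M 0 (f y) b : 'M[R]_(p + q)).
Proof.
move=> sf; apply: smooth_mx => i j.
case: (split_ordP i) => a ->; case: (split_ordP j) => l ->.
- apply: smooth_eq (smooth_cst x ((1%:M : 'M[R]_p) a l : R^o)) => y.
  by rewrite block_mxEul.
- by apply: smooth_eq (smooth_cst x (0 : R^o)) => y; rewrite block_mxEur mxE.
- by apply: smooth_eq (smooth_coord a l sf) => y; rewrite block_mxEdl.
- by apply: smooth_eq (smooth_cst x (b a l : R^o)) => y; rewrite block_mxEdr.
Qed.

End SmoothBlock.

(** * Versality of the translations in the last coordinate *)

Section Corank1Versal.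
Context {R : realType} {d : nat}.
Local Notation E := 'cV[R]_(d + 1).
Local Notation zI := (rshift d 0 : 'I_(d + 1)).

Variables (X : E -> E) (xi : E).
Hypothesis mX : map_germ X.
Let Xy x : 'cV[R]_d := usubmx (X x).
Let Xz x : R^o := X x zI 0.
Hypothesis Xy_inj : forall y : 'cV[R]_d, 'D_(col_mx y 0) Xy 0 = 0 -> y = 0.
Hypothesis DXz : forall x, 'D_x Xz 0 = 0.
Hypothesis xi1 : dsubmx xi = 1%:M.
Hypothesis DXy_xi : 'D_xi Xy 0 = 0.
Hypothesis DDXz : 'D_xi ('D_xi Xz) 0 != 0.

Lemma col_mx_last (v : E) : v = col_mx (usubmx v) (const_mx (v zI 0)).
Proof.
rewrite -[LHS]vsubmxK; congr col_mx; apply/colP => i.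
by rewrite (ord1 i) !mxE.
Qed.

(* phi (x, mu) is the point where the undeformed germ has the reduced coordinates
   that the deformation G has at (x, mu). *)
Lemma translation_family_versal :
  versal (P := R^o) X (fun lambda x => X x + lambda *: delta_mx zI 0).
Proof.
have [sX X0] := mX.
split.
  split; last by apply: (@nearW _ (nbhs (0 : E))) => x; rewrite scale0r addr0.
  apply: smoothD.
    apply: (@smooth_comp_mx _ _ _ _ _ _ fst) => //.
    pose L : {linear (E * R^o)%type -> E} := fst.
    by apply: (@smooth_linear _ _ _ _ L) => y; exact: cvg_fst.
  pose L : {linear (E * R^o)%type -> R^o} := snd.
  have Lc : continuous L by move=> y; exact: cvg_snd.
  exact: (smooth_linear_comp (@mxscalel_continuous R _ _ (delta_mx zI 0))
           (smooth_linear _ Lc)).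
move=> k G dG; have [sG GX] := dG.
have [c [tau [eps [s [psi [[sc stau seps] [ss tau0 eps0] GE [[spsi psi0] [sr r0]] [psiK rK]]]]]]] :=
  corank1_normal_form mX Xy_inj DXz xi1 DXy_xi DDXz dG.
pose red := reduced X (tau \o pad0).
pose Gp (w : E * 'cV[R]_k) := G w.2 w.1.
pose th w := col_mx (usubmx (Gp w)) (const_mx (tau (join_col w))) : E.
have pad_join (x : E) : join_col (x, 0 : 'cV[R]_k) = pad0 x by [].
have stj : smooth_germ 0 (tau \o join_col).
  by apply: smooth_comp; [exact: smooth_join_col|rewrite join_col0].
have pad_cont : continuous (pad0 : E -> 'cV[R]_(d + 1 + k)).
  exact: linear_col_continuous.
have sth : smooth_germ 0 th.
  apply: smooth_col_mx.
    pose Lu : {linear E -> 'cV[R]_d} := usubmx.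
    have Lu_cont : continuous Lu by exact: linear_col_continuous.
    exact: (smooth_linear_comp Lu_cont sG).
  by apply: smooth_mx => i j; apply: smooth_eq stj => x; rewrite mxE.
have thred : \forall x \near (0 : E), th (x, 0) = red x.
  by apply: filterS GX => x xE; rewrite /th /Gp /= xE pad_join.
have th0 : th 0 = 0 by rewrite -[0 in LHS]/((0 : E, 0 : 'cV[R]_k)) (nbhs_singleton thred).
pose phi w := psi (th w).
have sphi : smooth_germ 0 phi by apply: smooth_comp_mx => //; rewrite th0.
have phi0 : phi 0 = 0 by rewrite /phi th0.
have phi1 : \forall x \near (0 : E), phi (x, 0) = x.
  by apply: filterS2 thred psiK => x xE xK; rewrite /phi xE.
(* [Xy] and [tau] at [phi w] equal their counterparts for G at w, so the z-components of G and of X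
   translated by eps differ exactly by this row applied to [Xy (phi w)]. At mu = 0 the row vanishes
   because phi (x, 0) = x. *)
pose cc w := (\row_i (c i (join_col w) - c i (pad0 (phi w)))) : 'M[R]_(1, d).
have scc : smooth_germ 0 cc.
  apply: smooth_mx => i j.
  have s1 : smooth_germ 0 (c j \o join_col).
    by apply: smooth_comp; [exact: smooth_join_col|rewrite join_col0].
  have s2 : smooth_germ 0 ((c j \o pad0) \o phi).
    apply: smooth_comp => //; rewrite phi0.
    by apply: smooth_comp_linear => //; rewrite linear0.
  by apply: smooth_eq (smoothD s1 (smoothN s2)) => w; rewrite mxE.
exists (fun w => block_mx 1%:M 0 (cc w) 1%:M), phi, eps; split.
- split; first exact: smooth_lower_block.
  apply: filterS phi1 => x xE.
  have -> : cc (x, 0) = 0.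
    by apply/rowP => i; rewrite !mxE xE pad_join subrr.
  by rewrite -scalar_mx_block.
- by [].
- by [].
have XE : \forall x \near (0 : E), Xz x =
    \sum_i Xy x i 0 * c i (pad0 x) + s * tau (pad0 x) ^+ 2.
  have spad : smooth_germ 0 (pad0 : E -> 'cV[R]_(d + 1 + k)) by exact: smooth_linear.
  have pad00 : pad0 (0 : E) = 0 :> 'cV[R]_(d + 1 + k) by exact: linear0.
  apply: filterS2 GX (near_map_germ spad pad00 GE) => x xE.
  by rewrite /pad0 col_mxKu col_mxKd xE eps0 addr0.
have sjoin := @smooth_join_col R (d + 1) k 0.
have n1 := near_map_germ sjoin (join_col0) GE.
have n2 := near_map_germ sth th0 rK.
have n3 := near_map_germ sphi phi0 XE.
apply: filterS2 (filterI n1 n2) n3 => w [h1 h2] h3.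
rewrite /join_col col_mxKu col_mxKd -/(join_col w) in h1.
have [hy ht] : Xy (phi w) = usubmx (Gp w) /\ tau (pad0 (phi w)) = tau (join_col w).
  move: h2; rewrite /reduced => /eq_col_mx[hy /matrixP/(_ 0 0)].
  by rewrite !mxE.
rewrite [LHS]col_mx_last [X (phi w) + _]col_mx_last.
rewrite mul_block_col mul1mx mul0mx addr0 mul1mx; congr col_mx.
  have -> : usubmx (X (phi w) + eps w.2 *: delta_mx zI 0) = Xy (phi w).
    apply/colP => i; rewrite !mxE eq_lrshift /= mulr0 addr0; reflexivity.
  by rewrite hy.
apply/colP => i; rewrite (ord1 i) !mxE !eqxx mulr1 -/(Xz (phi w)) h3 h1 ht addrA.
congr (_ + _); rewrite addrA; congr (_ + _).
rewrite -big_split; apply: eq_bigr => j _.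
rewrite -hy !mxE eq_lrshift /= mulr0 addr0 -[X (phi w) _ _]/(X (phi w) (lshift 1 j) 0).
ring.
Qed.

End Corank1Versal.

(** * Reduction to the standard fold *)

Section Corank1Fold.
Context {R : realType} {d : nat}.
Local Notation E := 'cV[R]_(d + 1).
Local Notation zI := (rshift d 0 : 'I_(d + 1)).

Variables (X : E -> E) (xi : E).
Hypothesis mX : map_germ X.
Let Xy x : 'cV[R]_d := usubmx (X x).
Let Xz x : R^o := X x zI 0.
Hypothesis Xy_inj : forall y : 'cV[R]_d, 'D_(col_mx y 0) Xy 0 = 0 -> y = 0.
Hypothesis DXz : forall x, 'D_x Xz 0 = 0.
Hypothesis xi1 : dsubmx xi = 1%:M.
Hypothesis DXy_xi : 'D_xi Xy 0 = 0.
Hypothesis DDXz : 'D_xi ('D_xi Xz) 0 != 0.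

Lemma corank1_fold : is_fold X.
Proof.
split=> //; have [sX X0] := mX.
(* The constant deformation with zero parameters lets the parametric normal form be reused for [X]
   alone. *)
have dG : deformation (P := 'cV[R]_0) X (fun=> X).
  split; last by apply: (@nearW _ (nbhs (0 : E))).
  apply: (@smooth_comp_mx _ _ _ _ _ _ fst) => //.
  pose L : {linear (E * 'cV[R]_0)%type -> E} := fst.
  by apply: (@smooth_linear _ _ _ _ L) => y; exact: cvg_fst.
have [c [tau [eps [s [psi [[sc stau seps] [ss tau0 eps0] GE [mpsi [sr r0]] [psiK rK]]]]]]] :=
  corank1_normal_form mX Xy_inj DXz xi1 DXy_xi DDXz dG.
have [spsi psi0] := mpsi.
pose red := reduced X (tau \o pad0).
have XE : \forall x \near (0 : E), Xz x =
    \sum_i Xy x i 0 * c i (pad0 x) + s * tau (pad0 x) ^+ 2.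
  have pad_cont : continuous (pad0 : E -> 'cV[R]_(d + 1 + 0)).
    exact: linear_col_continuous.
  have spad : smooth_germ 0 (pad0 : E -> 'cV[R]_(d + 1 + 0)) by exact: smooth_linear.
  have pad00 : pad0 (0 : E) = 0 :> 'cV[R]_(d + 1 + 0) by exact: linear0.
  apply: filterS (near_map_germ spad pad00 GE) => x.
  rewrite /pad0 col_mxKu col_mxKd eps0 addr0; exact.
have o_lt : (0 < d + 1)%N by rewrite addn1.
(* fold_map squares the first coordinate, the normal form the last one. *)
pose o : 'I_(d + 1) := Ordinal o_lt.
pose t := tperm o zI.
pose pi : {linear E -> E} := row_perm t.
have pi_cont : continuous pi by exact: linear_col_continuous.
have piE (x : E) i : pi x i 0 = x (t i) 0 by rewrite mxE.
have piK x : pi (pi x) = x by apply/colP => i; rewrite !piE tpermK.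
have spi x : smooth_germ x pi by exact: smooth_linear.
pose phi x := psi (pi x).
have sphi : smooth_germ 0 phi.
  by apply: (smooth_comp_linear pi_cont); rewrite linear0.
have phi0 : phi 0 = 0 by rewrite /phi linear0.
have spad_phi i : smooth_germ 0 (fun x => c i (pad0 (phi x))).
  have pad_cont : continuous (pad0 : E -> 'cV[R]_(d + 1 + 0)).
    exact: linear_col_continuous.
  apply: (smooth_comp (g := c i \o pad0) sphi); rewrite phi0.
  by apply: (smooth_comp_linear pad_cont); rewrite linear0.
(* The last row of [B] computes s * (X_z - sum_i c_i f_i) = s * s * tau ^ 2 = tau ^ 2. *)
pose row_c x : 'M[R]_(1, d) := \row_i (- s * c i (pad0 (phi x))).
have srow : smooth_germ 0 row_c.
  apply: smooth_mx => i j.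
  by apply: smooth_eq (smoothM (smooth_cst 0 (- s : R^o)) (spad_phi j)) => x; rewrite mxE.
pose B x : 'M[R]_(d + 1) := block_mx 1%:M 0 (row_c x) s%:M.
have sB : smooth_germ 0 B by exact: smooth_lower_block.
exists (fun x => perm_mx t *m B x), phi; split.
- exact: smooth_mulmx (smooth_cst _ _) sB.
- apply: (@nearW _ (nbhs (0 : E))) => x.
  rewrite unitmx_mul unitmx_perm unitmxE det_lblock det1 mul1r det_scalar1.
  by rewrite unitfE; apply: contra_eq_neq ss => ->; rewrite mul0r eq_sym oner_neq0.
- split=> //; exists (pi \o red); split.
  + split; last by rewrite /= /red r0 linear0.
    exact: (smooth_linear_comp pi_cont).
  + apply: filterS (near_map_germ (spi 0) (linear0 pi) rK) => x xE.
    by rewrite /= /red xE piK.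
  + by apply: filterS psiK => x xE; rewrite /phi /= piK.
have n1 := near_map_germ sphi phi0 XE.
have n2 := near_map_germ (spi 0) (linear0 pi) rK.
apply: filterS2 n1 n2 => x h1 h2.
have [hy ht] : Xy (phi x) = usubmx (pi x) /\ tau (pad0 (phi x)) = pi x zI 0.
  move: h2; rewrite /reduced [RHS]col_mx_last => /eq_col_mx[hy /matrixP/(_ 0 0)].
  by rewrite !mxE.
rewrite -mulmxA -row_permE [X (phi x)]col_mx_last mul_block_col mul1mx mul0mx addr0.
apply/colP => i; rewrite mxE [RHS]mxE.
have last_entry : row_c x *m usubmx (X (phi x)) + s%:M *m const_mx (X (phi x) zI 0) =
    const_mx (pi x zI 0 ^+ 2).
  apply/colP => l; rewrite (ord1 l) mul_scalar_mx !mxE -/(Xz (phi x)) h1 ht.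
  rewrite mulrDr [s * (s * _)]mulrA ss mul1r addrA.
  rewrite [X in X + _ = _](_ : _ = 0) ?add0r ?piE //.
  rewrite mulr_sumr -big_split big1 //= => j _.
  rewrite mxE -/(Xy _ j 0) [usubmx _ j 0]/(Xy (phi x) j 0); ring.
rewrite last_entry -/(Xy (phi x)) hy.
have [ti|] := eqVneq (t i) zI.
  have io : i = o by rewrite -[i](tpermK o zI) -/t ti tpermR.
  by rewrite ti col_mxEd mxE piE -/t /t tpermR io.
move=> tiz; have io : i != o by apply: contra_neq tiz => ->; rewrite /t tpermL.
have -> : (i == 0%N :> nat) = false by apply/negbTE; apply: contra_neq io => i0; apply/val_inj.
case: (split_ordP (t i)) tiz => [j tj _|j -> ]; last by rewrite (ord1 j) eqxx.
by rewrite tj col_mxEu mxE piE -tj tpermK.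
Qed.

End Corank1Fold.

(** * Contact vector fields *)

(** The zero last row contributes one factor X to the characteristic polynomial; simplicity leaves
    none for [B], so 0 is not a root of [char_poly B] and [\det B] is nonzero. *)
Lemma unitmx_of_simple_eigenvalue0 {R : realType} {d : nat} (B : 'M[R]_d) (c : 'M[R]_(d, 1)) :
  mup 0 (char_poly (block_mx B c 0 0 : 'M[R]_(d + 1))) = 1%N -> B \in unitmx.
Proof.
have -> : char_poly (block_mx B c 0 0 : 'M[R]_(d + 1)) = char_poly B * ('X - 0%:P) ^+ 1.
  rewrite expr1 /char_poly /char_poly_mx.
  have -> : 'X%:M - map_mx polyC (block_mx B c 0 0 : 'M[R]_(d + 1)) =
      block_mx ('X%:M - map_mx polyC B) (- map_mx polyC c) 0 ('X - 0%:P)%:M.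
    rewrite polyC0 subr0 map_block_mx !map_mx0 scalar_mx_block opp_block_mx add_block_mx.
    by rewrite !oppr0 !addr0 add0r.
  by rewrite det_ublock det_scalar1.
have B0 : char_poly B != 0 by apply: monic_neq0; exact: char_poly_monic.
rewrite mupM // ?expf_neq0 ?polyXsubC_eq0 // mup_XsubCX eqxx => mup1.
rewrite unitmxE unitfE; apply: contraPneq mup1 => detB.
have : root (char_poly B) 0.
  by rewrite rootE horner_coef0 char_poly_det detB mulr0.
by rewrite root_factor_theorem XsubC_dvd // addn1 => + [mup0]; rewrite mup0.
Qed.

Section ContactField.
Context {R : realType} {n : nat}.
Local Notation E := 'cV[R]_(n + n + 1).
Variable H : E -> R.

Lemma partial_subC i (c : R) : partial i (fun w => H w - c) = partial i H.
Proof.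
apply/funext => w; rewrite /partial /derive.
have -> // : (fun h : R => h^-1 *: ((H (h *: delta_mx i 0 + w) - c) - (H w - c))) =
  (fun h : R => h^-1 *: (H (h *: delta_mx i 0 + w) - H w)).
by apply/funext => h; rewrite opprB addrA subrK.
Qed.

(** [H] occurs undifferentiated only in the z-component, so subtracting a constant from it
    translates the field along z. *)
Lemma contact_field_subC (c : R) (w : E) :
  contact_field (fun w => H w - c) w = contact_field H w + c *: delta_mx (rshift (n + n) 0) 0.
Proof.
apply/colP => i; rewrite [RHS]mxE [X in _ = _ + X]mxE [X in c * X]mxE eqxx andbT.
case: (split_ordP i) => j ->.
  rewrite eq_lrshift mulr0 addr0 !col_mxEu; case: (split_ordP j) => l ->.
    by rewrite !col_mxEu !mxE partial_subC.
  by rewrite !col_mxEd !mxE !partial_subC.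
rewrite !col_mxEd !mxE (ord1 j) eqxx mulr1 opprB addrA addrAC; congr (_ - _ + _).
by apply: eq_bigr => l _; rewrite partial_subC.
Qed.

End ContactField.

Section ContactEquilibrium.
Context {R : realType} {n : nat}.
Local Notation E := 'cV[R]_(n + n + 1).
Variable H : E -> R^o.
Hypothesis sH : smooth_germ 0 H.

Lemma smooth_partial i : smooth_germ 0 (partial i H : E -> R^o).
Proof. exact: smooth_derive. Qed.

Lemma smooth_entry i x : smooth_germ x (fun w : E => w i 0 : R^o).
Proof. by apply: (@smooth_linear _ _ _ x (@mxcoord R _ _ i 0)); exact: mxcoord_continuous. Qed.

Lemma derive_entry i (v x : E) : 'D_v (fun w : E => w i 0 : R^o) x = v i 0.
Proof. by apply: (@derive_linear _ _ _ (@mxcoord R _ _ i 0)); exact: mxcoord_continuous. Qed.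

Definition contact_q j (w : E) : R^o := partial (pI j) H w.
Definition contact_p j (w : E) : R^o :=
  - partial (qI j) H w - w (pI j) 0 * partial (zI 0) H w.
Definition contact_z (w : E) : R^o := \sum_j w (pI j) 0 * partial (pI j) H w - H w.

Lemma contact_fieldE w : contact_field H w =
  col_mx (col_mx (\col_j contact_q j w) (\col_j contact_p j w)) (\col_(_ < 1) contact_z w).
Proof. by []. Qed.

Lemma smooth_contact_q j : smooth_germ 0 (contact_q j).
Proof. exact: smooth_partial. Qed.

Lemma smooth_contact_p j : smooth_germ 0 (contact_p j).
Proof.
apply: smoothD; first exact/smoothN/smooth_partial.
by apply/smoothN/smoothM; [exact: smooth_entry|exact: smooth_partial].
Qed.

Lemma smooth_contact_z : smooth_germ 0 contact_z.
Proof.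
apply: smoothD; last exact: smoothN.
apply: smooth_sum => j _; apply: smoothM; [exact: smooth_entry|exact: smooth_partial].
Qed.

Lemma smooth_contact_field : smooth_germ 0 (contact_field H).
Proof.
apply: smooth_col_mx; first apply: smooth_col_mx.
- by apply: smooth_mx => i j; apply: smooth_eq (smooth_contact_q i) => w; rewrite mxE.
- by apply: smooth_mx => i j; apply: smooth_eq (smooth_contact_p i) => w; rewrite mxE.
- by apply: smooth_mx => i j; apply: smooth_eq smooth_contact_z => w; rewrite mxE.
Qed.

Lemma derive_partial_hessian i v : 'D_v (partial i H : E -> R^o) 0 = (hessian H 0 *m v) i 0.
Proof.
rewrite derive_partial; last exact/smooth_differentiable/smooth_partial.
by rewrite mxE; apply: eq_bigr => j _; rewrite mxE mulrC.
Qed.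

Hypothesis X0 : contact_field H 0 = 0.
Hypothesis tau0 : principal_coefficient H = 0.

(** At p = 0 the equilibrium equations read H_p = 0 and - H_q = 0; the z-derivative is the principal
    coefficient up to sign. *)
Lemma critical_point i : partial i H 0 = 0.
Proof.
have pz : partial (zI 0) H 0 = 0.
  by move/eqP: tau0; rewrite /principal_coefficient oppr_eq0 => /eqP.
case: (split_ordP i) => j ->; last by rewrite (ord1 j).
case: (split_ordP j) => l ->.
  have /matrixP/(_ (pI l) 0) := X0.
  have := X0 => /matrixP/(_ (lshift 1 (rshift n l)) 0).
  rewrite contact_fieldE col_mxEu col_mxEd !mxE /contact_p mxE mul0r subr0.
  by move/eqP; rewrite oppr_eq0 => /eqP.
have := X0 => /matrixP/(_ (lshift 1 (lshift n l)) 0).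
by rewrite contact_fieldE !col_mxEu !mxE /contact_q.
Qed.

Lemma derive_contact_q j v : 'D_v (contact_q j) 0 = (hessian H 0 *m v) (pI j) 0.
Proof. exact: derive_partial_hessian. Qed.

Lemma derive_contact_p j v : 'D_v (contact_p j) 0 = - (hessian H 0 *m v) (qI j) 0.
Proof.
have dp i := smooth_differentiable (smooth_partial i).
have dw := smooth_differentiable (smooth_entry (pI j) 0).
have dm := smooth_differentiable (smoothM (smooth_entry (pI j) 0) (smooth_partial (zI 0))).
have dN := smooth_differentiable (smoothN (smooth_partial (qI j))).
rewrite /contact_p deriveB_fun // deriveN_fun // deriveM_fun // derive_entry.
by rewrite critical_point mxE !mul0r addr0 subr0 derive_partial_hessian.
Qed.

(** Stated near the origin so that it can be differentiated once more. *)
Lemma derive_contact_z_near v : \forall w \near (0 : E), 'D_v contact_z w =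
  \sum_j (w (pI j) 0 * 'D_v (partial (pI j) H : E -> R^o) w + partial (pI j) H w * v (pI j) 0)
    - \sum_i v i 0 * partial i H w.
Proof.
have nE : \forall w \near (0 : E), forall i, differentiable (partial i H : E -> R^o) w.
  have dp i := smooth_near_differentiable (smooth_partial i).
  exact: (filter_forall (nbhs_filter (0 : E)) dp).
apply: filterS2 nE (smooth_near_differentiable sH) => w dp dH.
have de i := smooth_differentiable (smooth_entry i w).
have dm j : differentiable (fun y : E => y (pI j) 0 * partial (pI j) H y : R^o) w.
  by apply: differentiableM.
have ds : differentiable (fun y : E => \sum_j y (pI j) 0 * partial (pI j) H y : R^o) w.
  have -> : (fun y : E => \sum_j y (pI j) 0 * partial (pI j) H y : R^o) =
      \sum_j (fun y : E => y (pI j) 0 * partial (pI j) H y : R^o).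
    by apply/funext => y; rewrite fct_sumE.
  by apply: differentiable_sum.
rewrite /contact_z deriveB_fun // derive_sum_fun //; congr (_ - _).
  by apply: eq_bigr => j _; rewrite deriveM_fun // derive_entry.
by rewrite derive_partial.
Qed.

Lemma derive_contact_z v : 'D_v contact_z 0 = 0.
Proof.
rewrite (nbhs_singleton (derive_contact_z_near v)).
rewrite !big1 ?subrr // => [i _|j _]; first by rewrite critical_point mulr0.
by rewrite critical_point mxE !mul0r addr0.
Qed.

(** The sum of p_j H_{p_j} contributes twice v_{p_j} (Hess v)_{p_j}, which the hypothesis cancels; -
    H contributes minus the Hessian quadratic form. *)
Lemma derive2_contact_z v : (forall j, (hessian H 0 *m v) (pI j) 0 = 0) ->
  'D_v ('D_v contact_z) 0 = - \sum_i v i 0 * (hessian H 0 *m v) i 0.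
Proof.
move=> Hv; rewrite (near_eq_derive _ (derive_contact_z_near v)).
have sp := smooth_partial; have se i := smooth_entry i (0 : E).
have sDp j : smooth_germ 0 ('D_v (partial (pI j) H : E -> R^o)) by exact: smooth_derive.
have s1 j := smoothM (se (pI j)) (sDp j).
have s2 j := smoothM (sp (pI j)) (smooth_cst 0 (v (pI j) 0 : R^o)).
have s3 j := smoothD (s1 j) (s2 j).
have s4 i := smoothM (smooth_cst 0 (v i 0 : R^o)) (sp i).
have s5 := smooth_sum (index_enum _) (fun j (_ : xpredT j) => s3 j).
have s6 := smooth_sum (index_enum _) (fun i (_ : xpredT i) => s4 i).
have d f := @smooth_differentiable R E R^o 0 f.
rewrite deriveB_fun; [|exact: d s5|exact: d s6].
rewrite derive_sum_fun => [|j]; last exact: d (s3 j).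
rewrite derive_sum_fun => [|i]; last exact: d (s4 i).
rewrite big1 => [|j _].
  rewrite sub0r; congr (- _); apply: eq_bigr => i _.
  rewrite deriveM_fun; [|exact: d (smooth_cst _ _)|exact: d (sp i)].
  by rewrite derive_cst mulr0 addr0 derive_partial_hessian.
have -> : 'D_v (fun y : E => y (pI j) 0 * 'D_v (partial (pI j) H : E -> R^o) y +
    partial (pI j) H y * v (pI j) 0 : R^o) 0 =
  'D_v (fun y : E => y (pI j) 0 * 'D_v (partial (pI j) H : E -> R^o) y : R^o) 0 +
  'D_v (fun y : E => partial (pI j) H y * v (pI j) 0 : R^o) 0.
  by apply: (@deriveD _ _ R^o); apply: diff_derivable; [exact: d (s1 j)|exact: d (s2 j)].
rewrite deriveM_fun; [|exact: d (se _)|exact: d (sDp j)].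
rewrite deriveM_fun; [|exact: d (sp _)|exact: d (smooth_cst _ _)].
rewrite derive_cst derive_entry derive_partial_hessian Hv mxE.
by rewrite !(mulr0, mul0r, addr0).
Qed.

End ContactEquilibrium.

(** * The corank-one hypotheses for the contact field *)

Section ContactSaddleNode.
Context {R : realType} {n : nat}.
Local Notation E := 'cV[R]_(n + n + 1).
Variables (H : E -> R^o) (aq ap : 'cV[R]_n).
Hypothesis sH : smooth_germ 0 H.
Hypothesis X0 : contact_field H 0 = 0.
Hypothesis tau0 : principal_coefficient H = 0.
Hypothesis simple0 : simple_eigenvalue (linear_part (contact_field H) 0) 0.
Hypothesis Eq : hblock H qI qI *m aq + hblock H qI pI *m ap + hblock H qI zI = 0.
Hypothesis Ep : hblock H pI qI *m aq + hblock H pI pI *m ap + hblock H pI zI = 0.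
Hypothesis Delta2N0 : Delta2 H aq ap <> 0.

(** By [Eq] and [Ep] this vector lies in the kernel of the linear part; its z-component is
    normalised to 1 as [corank1_splitting] requires. *)
Definition kernel_direction : E := col_mx (col_mx aq ap) 1%:M.
Let xi := kernel_direction.
Let X := contact_field H.
Let Xy x : 'cV[R]_(n + n) := usubmx (X x).
Let Xz x : R^o := X x (rshift (n + n) 0) 0.

Lemma hessian_kernel_direction r (a : 'I_r -> 'I_(n + n + 1)) (i : 'I_r) :
  (hessian H 0 *m xi) (a i) 0 =
  (hblock H a qI *m aq + hblock H a pI *m ap + hblock H a zI) i 0.
Proof.
rewrite mxE big_split_ord /= big_split_ord /= big_ord1 [RHS]mxE [X in _ = X + _]mxE.
rewrite /xi /kernel_direction; congr (_ + _ + _).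
- by rewrite [RHS]mxE; apply: eq_bigr => j _; rewrite !col_mxEu [hblock _ _ _ _ _]mxE.
- by rewrite [RHS]mxE; apply: eq_bigr => j _; rewrite col_mxEu col_mxEd [hblock _ _ _ _ _]mxE.
by rewrite col_mxEd [hblock _ _ _ _ _]mxE [X in _ * X]mxE eqxx mulr1.
Qed.

Lemma contact_Xz : Xz = contact_z H.
Proof. by apply/funext => x; rewrite /Xz /X contact_fieldE col_mxEd mxE. Qed.

Lemma derive_contact_Xy v : 'D_v Xy 0 =
  col_mx (\col_j (hessian H 0 *m v) (pI j) 0) (\col_j - (hessian H 0 *m v) (qI j) 0).
Proof.
have -> : Xy = fun x => col_mx (\col_j contact_q H j x) (\col_j contact_p H j x).
  by apply/funext => x; rewrite /Xy /X contact_fieldE col_mxKu.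
have sq : smooth_germ 0 (fun x => \col_j contact_q H j x : 'cV[R]_n).
  by apply: smooth_mx => i j; apply: smooth_eq (smooth_contact_q sH i) => w; rewrite mxE.
have sp : smooth_germ 0 (fun x => \col_j contact_p H j x : 'cV[R]_n).
  by apply: smooth_mx => i j; apply: smooth_eq (smooth_contact_p sH i) => w; rewrite mxE.
rewrite derive_col_mx //; congr col_mx; apply/colP => j; rewrite [RHS]mxE.
  rewrite -derive_coord; last exact: smooth_differentiable.
  by rewrite -derive_contact_q //; congr ('D_v _ 0); apply/funext => x; rewrite mxE.
rewrite -derive_coord; last exact: smooth_differentiable.
by rewrite -derive_contact_p //; congr ('D_v _ 0); apply/funext => x; rewrite mxE.
Qed.

(** The last row of the linear part vanishes at a critical point, so simplicity of the eigenvalue 0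
    makes the (q,p)-block invertible. *)
Lemma contact_Xy_injective (y : 'cV[R]_(n + n)) : 'D_(col_mx y 0) Xy 0 = 0 -> y = 0.
Proof.
have dX := smooth_differentiable (smooth_contact_field sH).
pose L := linear_part X 0.
have DX v : 'D_v X 0 = L *m v by rewrite derive_linear_part.
have DXy v : 'D_v Xy 0 = usubmx (L *m v).
  rewrite -DX; apply/colP => i; rewrite [RHS]mxE -(derive_coord _ _ _ dX).
  rewrite -derive_coord; first by congr ('D_v _ 0); apply/funext => x; rewrite mxE.
  pose Lu : {linear E -> 'cV[R]_(n + n)} := usubmx.
  have Lu_cont : continuous Lu by exact: linear_col_continuous.
  by apply: (@differentiable_comp _ _ _ _ X Lu) => //; exact: linear_differentiable.
have Ld : dsubmx L = 0.
  apply/row_matrixP => i; rewrite (ord1 i) row0; apply/rowP => j; rewrite !mxE.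
  rewrite /partial -[LHS]/('D_(delta_mx j 0) Xz 0) contact_Xz.
  exact: derive_contact_z.
have LE : L = block_mx (ulsubmx L) (ursubmx L) 0 0.
  by rewrite -[LHS]submxK /dlsubmx /drsubmx Ld !linear0.
have uB : ulsubmx L \in unitmx.
  by apply: (@unitmx_of_simple_eigenvalue0 _ _ _ (ursubmx L)); rewrite -LE.
rewrite DXy LE mul_block_col mulmx0 addr0 col_mxKu => By.
by rewrite -[y](mulKmx uB) By mulmx0.
Qed.

Lemma contact_saddle_node_data :
  [/\ map_germ X, forall x, 'D_x Xz 0 = 0, 'D_xi Xy 0 = 0 & 'D_xi ('D_xi Xz) 0 != 0].
Proof.
have Hp j : (hessian H 0 *m xi) (pI j) 0 = 0 by rewrite hessian_kernel_direction Ep mxE.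
have Hq j : (hessian H 0 *m xi) (qI j) 0 = 0 by rewrite hessian_kernel_direction Eq mxE.
split.
- by split=> //; exact: smooth_contact_field.
- by move=> x; rewrite contact_Xz; exact: derive_contact_z.
- rewrite derive_contact_Xy; apply/colP => i.
  by case: (split_ordP i) => j ->; rewrite ?col_mxEu ?col_mxEd mxE ?Hp ?Hq ?oppr0 mxE.
(* In the quadratic form of [xi] the q and p terms drop out by [Hq] and [Hp]; the z term is 1 times
   [Delta2]. *)
rewrite contact_Xz derive2_contact_z // oppr_eq0.
rewrite big_split_ord /= big_split_ord /= big_ord1.
rewrite !big1 ?add0r => [|j _|j _]; [|by rewrite Hp mulr0|by rewrite Hq mulr0].
rewrite (hessian_kernel_direction (@zI n) 0) /xi col_mxEd mxE eqxx mul1r.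
exact/eqP.
Qed.

End ContactSaddleNode.

Theorem theorem3p1 (R : realType) (n : nat) (H : 'cV[R]_(n + n + 1) -> R)
  (smoothH : smooth_germ (W := R^o) 0 H)
  (eqH : degenerate_equilibrium (contact_field H) 0)
  (tauH : principal_coefficient H = 0)
  (simpleH : simple_eigenvalue (linear_part (contact_field H) 0) 0)
  (aq ap : 'cV[R]_n)
  (Eq : hblock H qI qI *m aq + hblock H qI pI *m ap + hblock H qI zI = 0)
  (Ep : hblock H pI qI *m aq + hblock H pI pI *m ap + hblock H pI zI = 0)
  (Delta2H : Delta2 H aq ap <> 0) :
  is_fold (contact_field H) /\
  saddle_node (contact_field H)
    (fun lambda : R => contact_field (fun w => H w - lambda)).
Proof.
have [X0 _] := eqH.
have [mX DXz DXy DDXz] := contact_saddle_node_data smoothH X0 tauH Eq Ep Delta2H.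
have inj := contact_Xy_injective smoothH X0 tauH simpleH.
have xi1 : dsubmx (kernel_direction aq ap) = 1%:M by rewrite col_mxKd.
have fold := corank1_fold mX inj DXz xi1 DXy DDXz.
split=> //; split=> //.
have -> : (fun lambda : R => contact_field (fun w => H w - lambda)) =
    (fun lambda x => contact_field H x + lambda *: delta_mx (rshift (n + n) 0) 0).
  by apply/funext => c; apply/funext => w; rewrite contact_field_subC.
exact: (translation_family_versal mX inj DXz xi1 DXy DDXz).
Qed.
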